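(* Let $n$ be a sample size, $\alpha\in(0,A]$ a privacy level such that $n\alpha^2>1$, $\beta,\delta>0$ smoothness parameters and $R>0$ a radius such that $R^2\ge d$. Let $J=2^{L+1}-1$ for some $L\in\mathbb N$. Consider the Coordinate dyadic block privacy mechanism $Q^{(J)}$ with block privacy levels $$\alpha_{\boldsymbol\ell}=\frac{\alpha}{S_{d,\delta}(J)}\,d_{\boldsymbol\ell}^{(1-\delta/d)/2},\qquad S_{d,\delta}(J)=\sum_{\boldsymbol\ell\in\{0,\dots,L\}^d}d_{\boldsymbol\ell}^{(1-\delta/d)/2},\qquad \boldsymbol\ell\in\{0,\dots,L\}^d.$$ Then the private projection estimator $\hat f_J$ satisfies $$\sup_{f\in\mathcal W^\beta(R)}\ \mathbb E\left[d_{\mathcal W^\delta(1)}(\hat f_J,f)\right]\le \begin{cases} C\,(n\alpha^2)^{-\frac{\beta+\delta}{2\beta+2d}} & \text{if }\delta<d\text{ and }J\asymp(n\alpha^2)^{\frac1{2\beta+2d}},\\[4pt] C\left(\dfrac{n\alpha^2}{[\log(n\alpha^2)]^{4d}}\right)^{-1/2} & \text{if }\delta=d\text{ and }J\asymp\left(\dfrac{n\alpha^2}{[\log(n\alpha^2)]^{4d}}\right)^{\frac1{2\beta+2\delta}},\\[4pt] C\,(n\alpha^2)^{-1/2} & \text{if }\delta>d\text{ and }J\asymp(n\alpha^2)^{\frac1{2\beta+2\delta}}, \end{cases}$$ where $C=C_{A,d,\delta,\beta,R}$ denotes a constant depending on $A$, $d$, $\delta$, $\beta$ and $R$.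
   Context: $d\ge1$ is an integer, $\mathbb N=\{0,1,2,\dots\}$, $\mathbb N^*$ the positive integers, $A>0$. $u_n\asymp v_n$ means that there are constants $c,C>0$ such that $c\le u_n/v_n\le C$ for all $n$; these constants are regarded as fixed. In the supremum, $f$ is the common probability density of the data. Fourier basis: $\varphi_1(t)=1$, $\varphi_{2j}(t)=\sqrt2\cos(2\pi jt)$, $\varphi_{2j+1}(t)=\sqrt2\sin(2\pi jt)$ for $j\in\mathbb N^*$, $t\in[0,1]$; $\varphi_{\mathbf j}(x)=\prod_{m=1}^d\varphi_{j_m}(x_m)$ for $\mathbf j\in(\mathbb N^* )^d$, $x\in[0,1]^d$; $\theta_{\mathbf j}(f)=\int_{[0,1]^d}f\varphi_{\mathbf j}$. Sobolev ball: $\mathcal W^\beta(R)=\{f\in L_2([0,1]^d):\sum_{\mathbf j\in(\mathbb N^* )^d}(j_1^{2\beta}+\dots+j_d^{2\beta})\theta_{\mathbf j}^2(f)\le R^2\}$. Adversarial loss: $d_{\mathcal G}(f_1,f_2)=\sup_{g\in\mathcal G}\int_{[0,1]^d}(f_1-f_2)g$. Dyadic blocks: for $\boldsymbol\ell\in\{0,\dots,L\}^d$, $\mathcal J_{\boldsymbol\ell}=\prod_{m=1}^d\{2^{\ell_m},\dots,2^{\ell_m+1}-1\}$, with cardinality $d_{\boldsymbol\ell}=\prod_{m=1}^d2^{\ell_m}$; these blocks partition $\{1,\dots,J\}^d$. Coordinate dyadic block privacy mechanism $Q^{(J)}$ with block privacy levels $\alpha_{\boldsymbol\ell}>0$, $\sum_{\boldsymbol\ell}\alpha_{\boldsymbol\ell}=\alpha$: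 let $B_0=2^{d/2}$. From $X\in[0,1]^d$ one generates $Z=(Z_{\mathbf j})_{\mathbf j\in\{1,\dots,J\}^d}$ by performing the following independently for every block $\boldsymbol\ell$, writing $v_{[\boldsymbol\ell]}=(v_{\mathbf j})_{\mathbf j\in\mathcal J_{\boldsymbol\ell}}$. (a) Draw $\tilde V_{[\boldsymbol\ell]}\in\{-B_0,B_0\}^{d_{\boldsymbol\ell}}$ with independent coordinates, $\tilde V_{\mathbf j}=B_0$ with probability $\frac12+\frac{\varphi_{\mathbf j}(X)}{2B_0}$ and $-B_0$ otherwise. (b) Put $B_{d_{\boldsymbol\ell}}(\alpha_{\boldsymbol\ell})=B_0\frac{e^{\alpha_{\boldsymbol\ell}}+1}{e^{\alpha_{\boldsymbol\ell}}-1}\Gamma_{d_{\boldsymbol\ell}}$, where $\frac1{\Gamma_k}=\frac1{2^{k-1}}\binom{k-1}{\lfloor(k-1)/2\rfloor}$. (c) Conditionally on $\tilde V_{[\boldsymbol\ell]}=\tilde v$, and independently of $X$, draw a Bernoulli variable $Y_{\boldsymbol\ell}$ of parameter $p_{\boldsymbol\ell}=1$ if $d_{\boldsymbol\ell}$ is odd and $p_{\boldsymbol\ell}=1-2^{-d_{\boldsymbol\ell}}\binom{d_{\boldsymbol\ell}}{d_{\boldsymbol\ell}/2}$ if $d_{\boldsymbol\ell}$ is even. If $Y_{\boldsymbol\ell}=1$, draw a Bernoulli variable $T_{\boldsymbol\ell}$ of parameter $\frac{e^{\alpha_{\boldsymbol\ell}}}{1+e^{\alpha_{\boldsymbol\ell}}}$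 and draw $Z_{[\boldsymbol\ell]}$ uniformly in the set of $z\in\{\pm B_{d_{\boldsymbol\ell}}(\alpha_{\boldsymbol\ell})\}^{d_{\boldsymbol\ell}}$ with $\langle z,\tilde v\rangle>0$ if $T_{\boldsymbol\ell}=1$, with $\langle z,\tilde v\rangle<0$ if $T_{\boldsymbol\ell}=0$. If $Y_{\boldsymbol\ell}=0$, draw $Z_{[\boldsymbol\ell]}$ uniformly in the set of such $z$ with $\langle z,\tilde v\rangle=0$. $Q^{(J)}$ applies this to each individual $X_i$ independently, producing $Z_i=(Z_{i,\mathbf j})_{\mathbf j}$, $1\le i\le n$, where $X_1,\dots,X_n$ are i.i.d. with density $f$ on $[0,1]^d$. Private projection estimator: $\hat f_J=\sum_{\mathbf j\in\{1,\dots,J\}^d}\hat\theta_{\mathbf j}\varphi_{\mathbf j}$ with $\hat\theta_{\mathbf j}=\frac1n\sum_{i=1}^nZ_{i,\mathbf j}$.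
   Formalization: In the case δ=d, nα²>1 is replaced by nα²≥ρ for an arbitrary ρ>1, with C also depending on ρ; as nα² tends to 1 the logarithm vanishes, the claimed bound tends to 0 and the literal statement fails. *)

(* Defs.v *)
From HB Require Import structures.
From mathcomp Require Import all_boot all_order all_algebra.
From mathcomp Require Import all_classical all_reals all_analysis.
From mathcomp Require Import zify.
Set Implicit Arguments.
Unset Strict Implicit.
Unset Printing Implicit Defensive.
Import Order.TTheory GRing.Theory Num.Theory.
Import numFieldNormedType.Exports.
Local Open Scope classical_set_scope.
Local Open Scope ring_scope.

Section lebesgue_tuple.
Context {R : realType}.

Definition consT d (p : R * d.-tuple R) : d.+1.-tuple R := [tuple of p.1 :: p.2].
Definition unconsT d (x : d.+1.-tuple R) : R * d.-tuple R :=
  (thead x, [tuple of behead x]).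

Lemma consTK d : cancel (@consT d) (@unconsT d).
Proof. by move=> [a t]; rewrite /consT /unconsT /=; congr pair; apply: val_inj. Qed.

Lemma unconsTK d : cancel (@unconsT d) (@consT d).
Proof. by move=> x; rewrite /consT /unconsT /= [RHS]tuple_eta. Qed.

Lemma measurable_consT d : measurable_fun setT (@consT d).
Proof. by apply: measurable_cons; [exact: measurable_fst|exact: measurable_snd]. Qed.

Lemma measurable_unconsT d : measurable_fun setT (@unconsT d).
Proof.
apply/measurable_fun_pairP; split.
  exact: measurable_tnth.
exact: measurable_behead.
Qed.

Section cons_measure.
Variables (d : nat) (m : {sigma_finite_measure set (d.-tuple R) -> \bar R}).

Definition cons_measure : set (d.+1.-tuple R) -> \bar R :=
  pushforward (lebesgue_measure \x m)%E (@consT d).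

Let cons_measure0 : cons_measure set0 = 0%E.
Proof. by rewrite /cons_measure /pushforward preimage_set0 measure0. Qed.

Let cons_measure_ge0 A : (0 <= cons_measure A)%E.
Proof. exact: (measure_ge0 (lebesgue_measure \x m)%E). Qed.

Let cons_measure_sigma_additive : semi_sigma_additive cons_measure.
Proof.
move=> F mF tF mUF; rewrite /cons_measure /pushforward preimage_bigcup.
apply: (@measure_semi_sigma_additive _ _ _ (lebesgue_measure \x m)%E).
- by move=> n; rewrite -[X in measurable X]setTI; exact: measurable_consT.
- apply/trivIsetP => /= i j _ _ ij; rewrite -preimage_setI.
  by move/trivIsetP : tF => /(_ _ _ _ _ ij) ->//; rewrite preimage_set0.
- by rewrite -preimage_bigcup -[X in measurable X]setTI; exact: measurable_consT.
Qed.

HB.instance Definition _ := isMeasure.Build _ _ _ cons_measure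
  cons_measure0 cons_measure_ge0 cons_measure_sigma_additive.

Let cons_measure_sigma_finite : sigma_finite setT cons_measure.
Proof.
have /sigma_finiteP[F [TF ndF Foo]] := sigma_finiteT (@lebesgue_measure R).
have /sigma_finiteP[G [TG ndG Goo]] := sigma_finiteT m.
exists (fun i => @unconsT d @^-1` (F i `*` G i)).
  rewrite -preimage_bigcup (_ : \bigcup_i _ = setT) ?preimage_setT//.
  apply/seteqP; split => // -[a t] _.
  have [i _ Fa] : (\bigcup_i F i) a by rewrite -TF.
  have [j _ Gt] : (\bigcup_j G j) t by rewrite -TG.
  exists (maxn i j) => //; split => /=.
    by move: a Fa; exact/subsetPset/ndF/leq_maxl.
  by move: t Gt; exact/subsetPset/ndG/leq_maxr.
move=> i; have [mF Fi] := Foo i; have [mG Gi] := Goo i; split.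
  by rewrite -[X in measurable X]setTI; apply: measurable_unconsT => //; exact: measurableX.
rewrite /cons_measure /pushforward -comp_preimage.
rewrite (_ : _ \o _ = id); last by apply/funext => p /=; rewrite consTK.
by rewrite preimage_id product_measure1E// lte_mul_pinfty// ge0_fin_numE.
Qed.

HB.instance Definition _ := Measure_isSigmaFinite.Build _ _ _ cons_measure
  cons_measure_sigma_finite.

End cons_measure.

Fixpoint lebesgue_tuple d : {sigma_finite_measure set (d.-tuple R) -> \bar R} :=
  match d with
  | 0 => \d_([tuple])
  | d'.+1 => cons_measure (lebesgue_tuple d')
  end.

Lemma lebesgue_tuple_box d (A : 'I_d -> set R) :
  (forall i, measurable (A i)) ->
  lebesgue_tuple d [set x | forall i, A i (tnth x i)] =
  (\prod_(i < d) lebesgue_measure (A i))%E.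
Proof.
elim: d A => [|d IH] A mA /=.
  rewrite big_ord0 diracE mem_set// => -[]//.
have mB : measurable [set x : d.-tuple R | forall i, A (lift ord0 i) (tnth x i)].
  rewrite (_ : [set x | _] =
    \bigcap_(i in [set: 'I_d]) (@tnth d R ^~ i @^-1` A (lift ord0 i))).
    apply: fin_bigcap_measurable => [|i _]; first exact: finite_finset.
    by rewrite -[X in measurable X]setTI; exact: measurable_tnth.
  by apply/seteqP; split => x /= H i; [move=> _|]; exact: H.
rewrite big_ord_recl -(IH (fun i => A (lift ord0 i)))// -product_measure1E//; last exact: mA.
rewrite /cons_measure /pushforward; congr ((lebesgue_measure \x _)%E _).
apply/seteqP; split => -[a t] /=.
  move=> H; split; first by have := H ord0; rewrite tnth0.
  by move=> i; have := H (lift ord0 i); rewrite tnthS.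
move=> [Aa At] i; case: (unliftP ord0 i) => [j ->|->]; last by rewrite tnth0.
by rewrite tnthS.
Qed.
End lebesgue_tuple.

Section sobolev.
Context {R : realType}.
Implicit Type d : nat.

Definition cube d : set (d.-tuple R) := [set x | forall m, tnth x m \in `[0, 1]].
#[global] Arguments cube d _ : clear implicits.

Definition fourier1 (j : nat) (t : R) : R :=
  if j == 1%N then 1
  else if odd j then Num.sqrt 2 * sin (2 * pi * j./2%:R * t)
  else Num.sqrt 2 * cos (2 * pi * j./2%:R * t).

Definition fourier d (j : {ffun 'I_d -> nat}) (x : d.-tuple R) : R :=
  \prod_(m < d) fourier1 (j m) (tnth x m).

Definition square_integrable d (f : d.-tuple R -> R) :=
  measurable_fun (cube d) f /\
  (lebesgue_tuple d).-integrable (cube d) (fun x => (f x ^+ 2)%:E).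

Definition fourier_coef d (f : d.-tuple R -> R) (j : {ffun 'I_d -> nat}) : R :=
  \int[lebesgue_tuple d]_(x in cube d) (f x * fourier j x).

Definition sobolev_ball d (beta r : R) : set (d.-tuple R -> R) :=
  [set f | square_integrable f /\
    (\esum_(j in [set j : {ffun 'I_d -> nat} | forall m, (0 < j m)%N])
       ((\sum_(m < d) (j m)%:R `^ (2 * beta)) * fourier_coef f j ^+ 2)%:E
     <= (r ^+ 2)%:E)%E].

Definition adversarial_loss d (G : set (d.-tuple R -> R)) (f1 f2 : d.-tuple R -> R)
    : \bar R :=
  ereal_sup [set (\int[lebesgue_tuple d]_(x in cube d) ((f1 x - f2 x) * g x)%:E)%E
            | g in G].

Definition is_density d (f : d.-tuple R -> R) :=
  [/\ measurable_fun (cube d) f, forall x, cube d x -> 0 <= f x &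
      (\int[lebesgue_tuple d]_(x in cube d) (f x)%:E = 1)%E].

End sobolev.

Section block_mechanism.
Context {R : realType}.
(* One block: its coordinates are indexed by the finite type K, so that its
   dimension is #|K|; a vector of {-b, b}^K is encoded by its pattern of signs,
   [true] standing for +b. *)
Variable K : finType.
Implicit Types (v z : {ffun K -> bool}) (a : R) (w : K -> R).

Definition signed (b : R) (s : bool) : R := if s then b else - b.

Definition Gamma (k : nat) : R := (2 ^+ k.-1) / 'C(k.-1, k.-1./2)%:R.

Definition amplitude (B0 a : R) (k : nat) : R :=
  B0 * ((expR a + 1) / (expR a - 1)) * Gamma k.

Definition rounding_pmf (B0 : R) w v : R :=
  \prod_(j : K) (if v j then 1 / 2 + w j / (2 * B0) else 1 - (1 / 2 + w j / (2 * B0))).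

(* The latent draws of the rounded vector v and of the Bernoulli variables Y and T
   are summed out: [sampling_pmf] is the law of z given v, [block_pmf] that of z. *)
Definition nonzero_prob : R :=
  if odd #|K| then 1 else 1 - 2 ^- #|K| * 'C(#|K|, #|K|./2)%:R.

Definition inner (B0 : R) a z v : R :=
  \sum_(j : K) signed (amplitude B0 a #|K|) (z j) * signed B0 (v j).

Definition uniform_pmf (S : {set {ffun K -> bool}}) z : R :=
  (z \in S)%:R / #|S|%:R.

Definition sampling_pmf (B0 : R) a v z : R :=
  nonzero_prob *
    (expR a / (1 + expR a) * uniform_pmf [set z' | 0 < inner B0 a z' v]%SET z
     + (1 - expR a / (1 + expR a)) * uniform_pmf [set z' | inner B0 a z' v < 0]%SET z)
  + (1 - nonzero_prob) * uniform_pmf [set z' | inner B0 a z' v == 0]%SET z.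

Definition block_pmf (B0 : R) a w z : R :=
  \sum_(v : {ffun K -> bool}) rounding_pmf B0 w v * sampling_pmf B0 a v z.

End block_mechanism.

Section dyadic_blocks.
Variables d L : nat.

Definition dyadic_size := (2 ^ L.+1 - 1)%N.

(* {1, ..., J}^d and {0, ..., L}^d; an element j : 'I_J stands for the
   frequency j + 1. *)
Definition mindex := {ffun 'I_d -> 'I_dyadic_size}.
Definition mlevel := {ffun 'I_d -> 'I_L.+1}.

Definition freq (j : mindex) : {ffun 'I_d -> nat} := [ffun m => (j m).+1].

Definition block (l : mlevel) : {set mindex} :=
  [set j : mindex | [forall m, 2 ^ l m <= freq j m < 2 ^ (l m).+1]%N]%SET.

Definition block_dim (l : mlevel) : nat := (\prod_(m < d) 2 ^ l m)%N.

(* the level of the unique block that contains j *)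
Definition level_of (j : mindex) : mlevel := [ffun m => inord (trunc_log 2 (freq j m))].

Lemma mem_block j l : (j \in block l) = (l == level_of j).
Proof.
have lt_freq m : (trunc_log 2 (freq j m) < L.+1)%N.
  rewrite ffunE; have := ltn_ord (j m); rewrite /dyadic_size ltn_subRL => jL.
  rewrite -(ltn_exp2l _ _ (isT : (1 < 2)%N)); apply: leq_ltn_trans jL.
  by rewrite add1n trunc_logP.
have levelE m : level_of j m = trunc_log 2 (freq j m) :> nat.
  by rewrite [in LHS]ffunE inordK.
rewrite inE; apply/forallP/eqP => [H|-> m].
  apply/ffunP => m; apply/val_inj; rewrite /= levelE.
  by apply/esym/trunc_log_eq.
by rewrite levelE trunc_logP ?ffunE// trunc_log_ltn.
Qed.

Lemma card_block l : #|block l| = block_dim l.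
Proof.
pose F m := [pred i : 'I_dyadic_size | 2 ^ l m <= i.+1 < 2 ^ (l m).+1]%N.
have -> : #|block l| = #|(family F : pred mindex)|.
  apply: eq_card => j; rewrite inE [RHS]unfold_in.
  by apply: eq_forallb => m; rewrite ffunE.
rewrite card_family foldrE big_map big_enum/=; apply: eq_bigr => m _.
have lm : (2 ^ (l m).+1 <= 2 ^ L.+1)%N by rewrite leq_exp2l.
have p0 : (0 < 2 ^ l m)%N by rewrite expn_gt0.
pose a := (2 ^ l m).-1; pose b := (2 ^ (l m).+1).-1.
have ab : (a <= b)%N by rewrite /a /b expnS; lia.
have bJ : (b <= dyadic_size)%N by rewrite /b /dyadic_size; lia.
rewrite -sum1_card (eq_bigl (fun i : 'I_dyadic_size => (a <= i < b)%N)); last first.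
  by move=> i; rewrite unfold_in /a /b expnS; lia.
rewrite -(big_mkord (fun i => a <= i < b)%N (fun=> 1%N)).
rewrite (big_cat_nat (leq0n a) (leq_trans ab bJ))/= (big_cat_nat ab bJ)/=.
rewrite big_nat_cond big1; last by move=> i; lia.
rewrite add0n [X in (_ + X)%N]big_nat_cond [X in (_ + X)%N]big1; last by move=> i; lia.
rewrite addn0 big_nat_cond (eq_bigl (fun i => ((a <= i < b) && true)%N)); last by move=> i; lia.
by rewrite -big_nat_cond sum_nat_const_nat muln1 /a /b expnS; lia.
Qed.

End dyadic_blocks.

Section estimator.
Context {R : realType}.
Variables (d L : nat).
Implicit Types (al : mlevel d L -> R).

Definition rounding_bound : R := 2 `^ (d%:R / 2).

(* the probability that Q^(J) releases, from x, the vector with sign pattern z *)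
Definition mechanism_pmf al (x : d.-tuple R) (z : {ffun mindex d L -> bool}) : R :=
  \prod_(l : mlevel d L)
    block_pmf (K := {j : mindex d L | j \in block l}) rounding_bound (al l)
      (fun j => fourier (freq (val j)) x) [ffun j => z (val j)].

Definition released al (z : {ffun mindex d L -> bool}) (j : mindex d L) : R :=
  signed (amplitude rounding_bound (al (level_of j)) (block_dim (level_of j))) (z j).

Definition theta_hat al n (z : 'I_n -> {ffun mindex d L -> bool}) (j : mindex d L) : R :=
  n%:R^-1 * \sum_(i < n) released al (z i) j.

Definition projection_estimator al n (z : 'I_n -> {ffun mindex d L -> bool})
    (x : d.-tuple R) : R :=
  \sum_(j : mindex d L) theta_hat al z j * fourier (freq j) x.

(* The pairs (X_i, Z_i) are independent, X_i has density f, and given X_i = x the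
   released vector is drawn from Q^(J)(x). [ps_Z] records the sign pattern of that
   vector; its actual value is [released al (ps_Z i w)]. *)
Record private_sample al n (f : d.-tuple R -> R) := PrivateSample {
  ps_display : measure_display;
  ps_space : measurableType ps_display;
  ps_prob : probability ps_space R;
  ps_X : 'I_n -> ps_space -> d.-tuple R;
  ps_Z : 'I_n -> ps_space -> {ffun mindex d L -> bool};
  ps_X_measurable : forall i, measurable_fun setT (ps_X i);
  ps_Z_measurable : forall i z, measurable (ps_Z i @^-1` [set z]);
  ps_law : forall (B : 'I_n -> set (d.-tuple R)) (z : 'I_n -> {ffun mindex d L -> bool}),
    (forall i, measurable (B i)) ->
    ps_prob [set w | forall i, B i (ps_X i w) /\ ps_Z i w = z i] =
    (\prod_(i < n)
       \int[lebesgue_tuple d]_(x in cube d `&` B i) (f x * mechanism_pmf al x (z i))%:E)%E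
}.

#[global] Arguments ps_X {al n f} p _ _.
#[global] Arguments ps_Z {al n f} p _ _.

Definition risk al n f (G : set (d.-tuple R -> R)) (S : private_sample al n f) : \bar R :=
  (\int[ps_prob S]_w
     adversarial_loss G (projection_estimator al (fun i => ps_Z S i w)) f)%E.

Definition sup_risk al n (F G : set (d.-tuple R -> R)) : \bar R :=
  ereal_sup [set r | exists f, [/\ F f, is_density f &
    exists S : private_sample al n f, r = risk G S]].

Definition level_sum (delta : R) : R :=
  \sum_(l : mlevel d L) (block_dim l)%:R `^ ((1 - delta / d%:R) / 2).

Definition privacy_levels (alpha delta : R) (l : mlevel d L) : R :=
  alpha / level_sum delta * (block_dim l)%:R `^ ((1 - delta / d%:R) / 2).

End estimator.

(* u ≍ v, with the two constants exposed *)
Definition of_order (R : realType) (c1 c2 u v : R) : Prop := c1 <= u / v <= c2.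

(* Main.v *)
Require Import Defs.
From HB Require Import structures.
From mathcomp Require Import all_boot all_order all_algebra.
From mathcomp Require Import all_classical all_reals all_analysis.
From mathcomp Require Import measurable_realfun.
From mathcomp Require Import zify ring lra.
Set Implicit Arguments.
Unset Strict Implicit.
Unset Printing Implicit Defensive.
Import Order.TTheory GRing.Theory Num.Theory.
Import numFieldNormedType.Exports.
Local Open Scope classical_set_scope.
Local Open Scope ring_scope.

(** The error of the estimator splits into a stochastic part, carried by the
    frequencies in the box {1, ..., J}^d, and the part of f outside that box.

    For g in the Sobolev ball of radius 1, Cauchy-Schwarz with the weights
    w_j = sum_m j_m ^ (2 delta) bounds the stochastic part by the square root of
    V = sum_j (hat theta_j - theta_j)^2 / w_j (adversarial_loss_le).  The part
    outside the box is at most r J ^ (- (beta + delta)) (approximation_error).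
    The second bound is an instance of Parseval's identity, hence needs that the
    trigonometric system is complete in L2 of the cube (trig_dense).  Completeness
    comes from Dynkin's theorem: the indicators of initial segments of the unit
    interval are limits of products of the polynomials
    (1 - p ^ n) ^ (n 2 ^ n), with p affine in cos (2 pi t) or sin (2 pi t), so that
    indicators of boxes, then of measurable sets, then all square integrable
    functions, are limits of trigonometric polynomials.

    The released value of a coordinate is unbiased given the individual
    (mechanism_unbiased) and its absolute value is a constant, the amplitude of
    its block; so the variance of hat theta_j is at most the squared amplitude
    over n (sample_mean_variance), and the expectation of V is at most
    n ^ -1 sum_l B_l^2 sum_(j in l) 1 / w_j.  Here B_l^2 is of order d_l / alpha_l^2
    because Gamma_k is at most of order sqrt k (Gamma_sqr_le), and w_j is at least
    d_l ^ (2 delta / d) on the block l (weight_ge_dim).  The prescribed privacy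
    levels turn this into a constant times
    (n alpha^2)^-1 (sum_(i <= L) q ^ i) ^ (2 d) (sum_(i <= L) q ^ (2 i)) ^ d
    with q = 2 ^ ((1 - delta / d) / 2) (noise_sum_le).

    The three regimes are q > 1, q = 1 and q < 1: the geometric sums are then of
    the order of their last term, of L, or bounded, and the prescribed J balances
    the result with the squared approximation error. *)

(** * One block of the mechanism *)

Lemma signedM (R : realType) (b : R) (s t : bool) :
  signed b (s == t) = signed 1 t * signed b s.
Proof. by case: s; case: t; rewrite /signed /= ?mul1r ?mulN1r ?opprK. Qed.

Lemma signedE (R : realType) (b : R) (s : bool) : signed b s = b * (2 * s%:R - 1).
Proof. by case: s; rewrite /signed /= ?mulr1n ?mulr0n; ring. Qed.

Lemma half_binomial_sym k : 'C(k.-1, k./2) = 'C(k.-1, k.-1./2).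
Proof.
case: k => //= k; rewrite -[LHS]bin_sub; last by lia.
by congr ('C(_, _)); lia.
Qed.

Section block.
Context {R : realType} (K : finType).
Implicit Types (A : {set K}) (v z : {ffun K -> bool}) (j : K).

(** Relative to [v], the law of the released pattern depends only on the set of
    coordinates that agree with [v]; all counting takes place on these sets. *)
Definition agreement v z : {set K} := [set j | z j == v j]%SET.
Definition agree_on v A : {ffun K -> bool} := [ffun j => (j \in A) == v j].

Lemma agree_onK v : cancel (agree_on v) (agreement v).
Proof.
by move=> A; apply/setP => j; rewrite inE ffunE; case: (j \in A); case: (v j).
Qed.

Lemma agreementK v : cancel (agreement v) (agree_on v).
Proof. by move=> z; apply/ffunP => j; rewrite ffunE inE; case: (z j); case: (v j). Qed.

Lemma sum_agreement v (P : pred {set K}) (h : {ffun K -> bool} -> R) :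
  \sum_(z | P (agreement v z)) h z = \sum_(A : {set K} | P A) h (agree_on v A).
Proof.
rewrite (reindex_onto (agree_on v) (agreement v)) /=; last by move=> *; exact: agreementK.
by apply: eq_bigl => A; rewrite agree_onK eqxx andbT.
Qed.

Lemma innerE (B0 a : R) v z : inner B0 a z v =
  amplitude B0 a #|K| * B0 * (2 * #|agreement v z|%:R - #|K|%:R).
Proof.
have -> : inner B0 a z v =
    \sum_j amplitude B0 a #|K| * B0 * (2 * (z j == v j)%:R - 1).
  apply: eq_bigr => j _.
  by case: (z j); case: (v j); rewrite /signed /= ?mulr1n ?mulr0n; ring.
rewrite -mulr_sumr big_split /= sumrN -mulr_sumr -natr_sum sumr_const.
congr (_ * (2 * _%:R - _)); rewrite -sum1_card [RHS]big_mkcond/=.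
by apply: eq_bigr => j _; rewrite inE; case: (_ == _).
Qed.

Definition majorities : {set {set K}} := [set A : {set K} | (#|K| < 2 * #|A|)%N]%SET.

Lemma sum_compl (h : {set K} -> R) (P : pred {set K}) :
  \sum_(A : {set K} | P A) h A = \sum_(A : {set K} | P (~: A)%SET) h (~: A)%SET.
Proof.
rewrite (reindex_onto (fun A : {set K} => ~: A)%SET (fun A : {set K} => ~: A)%SET)/=.
  by apply: eq_bigl => A; rewrite finset.setCK eqxx andbT.
by move=> A _; rewrite finset.setCK.
Qed.

(** Pairing a set that avoids [j] with the set obtained by adding [j] cancels
    all terms except those where this addition creates the majority. *)
Lemma sum_majorities j : \sum_(A : {set K} | (#|K| < 2 * #|A|)%N) signed 1 (j \in A)
  = 'C(#|K|.-1, #|K|./2)%:R :> R.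
Proof.
rewrite (bigID (fun A : {set K} => j \in A)) /=.
rewrite (eq_bigr (fun=> 1)); last by move=> A /andP[_ ->].
rewrite (reindex_onto (fun A : {set K} => j |: A)%SET (fun A : {set K} => A :\ j)%SET)/=;
  last by move=> A /andP[_ jA]; rewrite finset.setD1K.
rewrite (eq_bigl (fun A : {set K} => (j \notin A) && (#|K| < 2 * #|A|.+1)%N)); last first.
  move=> A; rewrite finset.setU11 andbT andbC; apply/andP/andP => -[].
    move=> /eqP jA; have jNA : j \notin A by rewrite -jA !inE eqxx.
    by rewrite cardsU1 jNA.
  by move=> jA; rewrite cardsU1 jA finset.setU1K.
rewrite [X in _ + X](eq_bigr (fun=> -1)); last by move=> A /andP[_ /negbTE ->].
rewrite [X in _ + X](eq_bigl (fun A : {set K} => (j \notin A) && (#|K| < 2 * #|A|)%N));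
  last by move=> A; rewrite andbC.
rewrite big_mkcondr [X in _ + X]big_mkcondr -big_split /=.
have cK : (0 < #|K|)%N by apply/card_gt0P; exists j.
have -> : #|K|.-1 = #|[set~ j]%SET| by rewrite cardsC1.
rewrite -cards_draws -(sumr_const _ (1 : R)) [RHS]big_mkcond/= big_mkcond/=.
apply: eq_bigr => A _; rewrite !inE finset.subsetC finset.sub1set inE.
have [jA|_] := boolP (j \notin A); rewrite //=.
case: ifPn => h1; case: ifPn => h2; case: eqP => h3; rewrite ?addr0 ?add0r ?subrr//; lia.
Qed.

Lemma sum_minorities j : \sum_(A : {set K} | (2 * #|A| < #|K|)%N) signed 1 (j \in A)
  = - 'C(#|K|.-1, #|K|./2)%:R :> R.
Proof.
rewrite sum_compl -(sum_majorities j) -sumrN; apply: eq_big => [A|A _].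
  by have := cardsC A; lia.
by rewrite finset.in_setC; case: (j \in A); rewrite /signed /= ?opprK.
Qed.

(** Complementation preserves ties and flips the sign of every coordinate. *)
Lemma sum_ties j : \sum_(A : {set K} | (2 * #|A| == #|K|)%N) signed 1 (j \in A) = 0 :> R.
Proof.
set s := LHS; have : s = - s.
  rewrite {1}/s sum_compl -sumrN; apply: eq_big => [A|A _].
    by have := cardsC A; lia.
  by rewrite finset.in_setC; case: (j \in A); rewrite /signed /= ?opprK.
lra.
Qed.

Lemma card_minorities : #|[set A : {set K} | (2 * #|A| < #|K|)%N]%SET| = #|majorities|.
Proof.
rewrite /majorities -[LHS]sum1_card -[RHS]sum1_card.
rewrite (reindex_onto (fun A : {set K} => ~: A)%SET (fun A : {set K} => ~: A)%SET)/=.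
  by apply: eq_bigl => A; rewrite finset.setCK eqxx andbT !inE -(cardsC A); apply/idP/idP; lia.
by move=> A _; rewrite finset.setCK.
Qed.

Definition ties : {set {set K}} := [set A : {set K} | (2 * #|A| == #|K|)%N]%SET.

Lemma card_ties : #|ties| = (if odd #|K| then 0 else 'C(#|K|, #|K|./2))%N.
Proof.
rewrite /ties; case: ifPn => oK.
  by apply: eq_card0 => A; rewrite !inE; lia.
by rewrite -card_draws; apply: eq_card => A; rewrite !inE; lia.
Qed.

Lemma card_sign_patterns : (2 * #|majorities| + #|ties| = 2 ^ #|K|)%N.
Proof.
rewrite mul2n -addnn -{1}card_minorities.
have -> : (2 ^ #|K| = #|powerset [set: K]%SET|)%N by rewrite card_powerset cardsT.
rewrite -[#|[set _ | _]%SET|]sum1_card -[#|majorities|]sum1_card -[#|ties|]sum1_card -[in RHS]sum1_card.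
rewrite [RHS]big_mkcond [X in (X + _ + _)%N]big_mkcond [X in (_ + X + _)%N]big_mkcond.
rewrite [X in (_ + X)%N]big_mkcond -!big_split/=; apply: eq_bigr => A _; rewrite !inE finset.subsetT.
by case: ltngtP.
Qed.

Lemma majorities_gt0 : (0 < #|K|)%N -> (0 < #|majorities|)%N.
Proof. by move=> K0; apply/card_gt0P; exists [set: K]%SET; rewrite inE cardsT; lia. Qed.

(** The parameter of the Bernoulli variable that decides for a tie is the
    proportion of ties among all sign patterns. *)
Lemma tie_probE : 1 - nonzero_prob K = #|ties|%:R / 2 ^+ #|K| :> R.
Proof.
rewrite card_ties /nonzero_prob; case: ifPn => _; first by rewrite subrr mul0r.
by rewrite opprB addrC subrK mulrC.
Qed.

Lemma nonzero_probE : nonzero_prob K = 2 * #|majorities|%:R / 2 ^+ #|K| :> R.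
Proof.
rewrite -[LHS](subKr 1) tie_probE.
have := card_sign_patterns => /(congr1 (GRing.natmul (1 : R))).
rewrite natrD natrM natrX => e.
have n0 : (2 : R) ^+ #|K| != 0 by rewrite expf_neq0.
by apply: (mulIf n0); rewrite mulrBl !divfK// mul1r -e addrK.
Qed.

Section sampling.
Variables (B0 a : R).
Hypotheses (B0_gt0 : 0 < B0) (a_gt0 : 0 < a) (K_gt0 : (0 < #|K|)%N).

Lemma amplitude_gt0 : 0 < amplitude B0 a #|K|.
Proof.
have ea : 1 < expR a by rewrite expR_gt1.
rewrite !mulr_gt0 ?invr_gt0 ?subr_gt0 ?addr_gt0 ?expR_gt0 ?exprn_gt0//.
by rewrite ltr0n bin_gt0; lia.
Qed.

Lemma inner_gt0 v z : (0 < inner B0 a z v) = (#|K| < 2 * #|agreement v z|)%N.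
Proof.
have h : 0 < amplitude B0 a #|K| * B0 by rewrite mulr_gt0 ?amplitude_gt0.
by rewrite innerE (pmulr_rgt0 _ h) subr_gt0 -natrM ltr_nat.
Qed.

Lemma inner_lt0 v z : (inner B0 a z v < 0) = (2 * #|agreement v z| < #|K|)%N.
Proof.
have h : 0 < amplitude B0 a #|K| * B0 by rewrite mulr_gt0 ?amplitude_gt0.
by rewrite innerE (pmulr_rlt0 _ h) subr_lt0 -natrM ltr_nat.
Qed.

Lemma inner_eq0 v z : (inner B0 a z v == 0) = (2 * #|agreement v z| == #|K|)%N.
Proof.
have h : 0 < amplitude B0 a #|K| * B0 by rewrite mulr_gt0 ?amplitude_gt0.
by rewrite innerE mulf_eq0 gt_eqF//= subr_eq0 -natrM eqr_nat.
Qed.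

Lemma sum_uniform (S : {set {ffun K -> bool}}) (v : {ffun K -> bool}) (P : pred {set K})
    (h : {ffun K -> bool} -> R) : (forall z, (z \in S) = P (agreement v z)) ->
  \sum_z uniform_pmf S z * h z =
  (\sum_(A : {set K} | P A) h (agree_on v A)) / #|[set A | P A]%SET|%:R.
Proof.
move=> SP.
rewrite (eq_bigr (fun z => (if P (agreement v z) then h z else 0) / #|S|%:R)); last first.
  by move=> z _; rewrite /uniform_pmf SP; case: ifP => _; rewrite ?mul1r ?mul0r// mulrC.
rewrite -mulr_suml -big_mkcond sum_agreement; congr (_ / _%:R).
rewrite -(card_imset _ (can_inj (agreementK v))); apply: eq_card => A; rewrite inE.
apply/imsetP/idP => [[z zS ->]|PA]; first by rewrite -SP.
by exists (agree_on v A); rewrite ?SP agree_onK.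
Qed.

(** Since the event of a tie is drawn with its uniform probability, the sizes of
    the three events cancel: every pattern has its uniform probability, except
    for the bias of the coin between the two strict events. *)
Lemma sum_sampling v (h : {ffun K -> bool} -> R) :
  \sum_z sampling_pmf B0 a v z * h z =
  2 / 2 ^+ #|K| *
    (expR a / (1 + expR a) * \sum_(A : {set K} | (#|K| < 2 * #|A|)%N) h (agree_on v A)
     + (1 - expR a / (1 + expR a)) *
       \sum_(A : {set K} | (2 * #|A| < #|K|)%N) h (agree_on v A))
  + (\sum_(A : {set K} | (2 * #|A| == #|K|)%N) h (agree_on v A)) / 2 ^+ #|K|.
Proof.
rewrite /sampling_pmf; set q := expR a / _.
set p := nonzero_prob K.
rewrite (eq_bigr (fun z => p * q * (uniform_pmf [set z' | 0 < inner B0 a z' v]%SET z * h z)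
  + p * (1 - q) * (uniform_pmf [set z' | inner B0 a z' v < 0]%SET z * h z)
  + (1 - p) * (uniform_pmf [set z' | inner B0 a z' v == 0]%SET z * h z))); last first.
  by move=> z _; ring.
rewrite !big_split/= -!mulr_sumr.
rewrite (@sum_uniform _ v (fun A => #|K| < 2 * #|A|)%N); last by move=> z; rewrite inE inner_gt0.
rewrite (@sum_uniform _ v (fun A => 2 * #|A| < #|K|)%N); last by move=> z; rewrite inE inner_lt0.
rewrite (@sum_uniform _ v (fun A => 2 * #|A| == #|K|)%N); last by move=> z; rewrite inE inner_eq0.
rewrite card_minorities -/majorities -/ties /p tie_probE nonzero_probE.
have M0 : #|majorities|%:R != 0 :> R by rewrite pnatr_eq0; have := majorities_gt0 K_gt0; lia.
have n0 : (2 : R) ^+ #|K| != 0 by rewrite expf_neq0.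
set S1 := \sum_(_ | _) _; set S2 := \sum_(_ | _) _; set S3 := \sum_(_ | _) _.
congr (_ + _); first by field; rewrite n0 M0.
have [t0|t0] := eqVneq #|ties| 0%N; last by field; rewrite n0 pnatr_eq0 t0.
rewrite t0 mul0r mul0r /S3 big_pred0 ?mul0r// => A.
by move/eqP: t0; rewrite cards_eq0 => /eqP/setP/(_ A); rewrite !inE.
Qed.

Lemma sum_sampling_pmf v : \sum_z sampling_pmf B0 a v z = 1.
Proof.
have := sum_sampling v (fun=> 1).
under eq_bigr do rewrite mulr1.
move=> ->; rewrite !sumr_const.
have -> : #|[pred A : {set K} | #|K| < 2 * #|A|]%N| = #|majorities|.
  by apply: eq_card => A; rewrite !inE.
have -> : #|[pred A : {set K} | 2 * #|A| == #|K|]%N| = #|ties|.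
  by apply: eq_card => A; rewrite !inE.
have -> : #|[pred A : {set K} | 2 * #|A| < #|K|]%N| = #|majorities|.
  by rewrite -card_minorities; apply: eq_card => A; rewrite !inE.
have := card_sign_patterns => /(congr1 (GRing.natmul (1 : R))).
rewrite natrD natrM natrX => e.
have n0 : (2 : R) ^+ #|K| != 0 by rewrite expf_neq0.
apply: (mulIf n0); rewrite mul1r -[RHS]e; field; rewrite n0.
by rewrite gt_eqF// addr_gt0// expR_gt0.
Qed.

(** The mean of a coordinate over the majorities is proportional to
    [Gamma #|K|]^-1, and the coin between majorities and minorities contributes
    (e^a - 1) / (e^a + 1); the amplitude is the inverse of this product. *)
Lemma amplitude_unbiased j v :
  \sum_z sampling_pmf B0 a v z * signed (amplitude B0 a #|K|) (z j) = signed B0 (v j).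
Proof.
rewrite sum_sampling; set b := amplitude _ _ _.
have E (P : pred {set K}) : \sum_(A : {set K} | P A) signed b (agree_on v A j) =
    signed 1 (v j) * b * \sum_(A : {set K} | P A) signed 1 (j \in A).
  rewrite mulr_sumr; apply: eq_bigr => A _.
  by rewrite ffunE signedM (signedE b) (signedE 1 (j \in A)) mul1r mulrA.
rewrite !E sum_majorities sum_minorities sum_ties mulr0 mul0r addr0.
rewrite half_binomial_sym !signedE /b /amplitude /Gamma mul1r.
have -> : (2 : R) ^+ #|K| = 2 * 2 ^+ #|K|.-1 by rewrite -exprS prednK.
have n0 : (2 : R) ^+ #|K|.-1 != 0 by rewrite expf_neq0.
have b0 : 'C(#|K|.-1, #|K|.-1./2)%:R != 0 :> R.
  by rewrite pnatr_eq0 -lt0n bin_gt0; lia.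
have e0 : 1 + expR a != 0 by rewrite gt_eqF// addr_gt0// expR_gt0.
have e1 : expR a - 1 != 0 by rewrite gt_eqF// subr_gt0 expR_gt1.
by field; rewrite e0 b0 n0 e1.
Qed.
End sampling.

(** Serves the total mass of the rounding law (constant [h]) and its means. *)
Lemma sum_prod_coordinate (p : K -> R) (j : K) (h : bool -> R) :
  \sum_(v : {ffun K -> bool}) (\prod_(i : K) (if v i then p i else 1 - p i)) * h (v j) =
  p j * h true + (1 - p j) * h false.
Proof.
pose F (i : K) (b : bool) := (if b then p i else 1 - p i) * (if i == j then h b else 1).
transitivity (\sum_(v : {ffun K -> bool}) \prod_(i : K) F i (v i)).
  apply: eq_bigr => v _; rewrite /F big_split/=; congr (_ * _).
  by rewrite -big_mkcond big_pred1_eq.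
rewrite -bigA_distr_bigA (bigD1 j)//= big_bool /F eqxx big1 ?mulr1// => i /negbTE ij.
by rewrite big_bool /= ij; ring.
Qed.

Section block_law.
Variables (B0 a : R) (w : K -> R).
Hypotheses (B0_gt0 : 0 < B0) (a_gt0 : 0 < a) (K_gt0 : (0 < #|K|)%N).

Lemma sum_rounding_pmf : \sum_v rounding_pmf B0 w v = 1.
Proof.
have /card_gt0P[j _] := K_gt0.
have := sum_prod_coordinate (fun i => 1 / 2 + w i / (2 * B0)) j (fun=> 1).
by under eq_bigr do rewrite mulr1; rewrite /rounding_pmf => ->; ring.
Qed.

Lemma rounding_unbiased j : \sum_v rounding_pmf B0 w v * signed B0 (v j) = w j.
Proof.
rewrite (sum_prod_coordinate (fun i => 1 / 2 + w i / (2 * B0)) j (signed B0)) /signed.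
by field; rewrite gt_eqF.
Qed.

Lemma sum_block_pmf : \sum_z block_pmf B0 a w z = 1.
Proof.
rewrite exchange_big/= -[RHS]sum_rounding_pmf; apply: eq_bigr => v _.
by rewrite -mulr_sumr sum_sampling_pmf// mulr1.
Qed.

Lemma block_unbiased j :
  \sum_z block_pmf B0 a w z * signed (amplitude B0 a #|K|) (z j) = w j.
Proof.
under eq_bigr do rewrite mulr_suml.
rewrite exchange_big/= -[RHS]rounding_unbiased; apply: eq_bigr => v _.
by under eq_bigr do rewrite -mulrA; rewrite -mulr_sumr amplitude_unbiased.
Qed.
End block_law.
End block.

(** In the induction step the factor 4 n + 1 suffices because
    (2 n + 1)^2 (4 n + 5) >= 4 (n + 1)^2 (4 n + 1). *)
Lemma central_binomial_ge n : (16 ^ n <= (4 * n + 1) * 'C(n.*2, n) ^ 2)%N.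
Proof.
elim: n => // n IH.
have e1 : (n.+1 * 'C(n.+1.*2, n.+1) = (2 * (2 * n + 1)) * 'C(n.*2, n))%N.
  have h1 := mul_bin_diag n.+1.*2 n; have h2 := mul_bin_diag n.*2.+1 n.
  have h3 : ('C(n.*2.+1, n.+1) = 'C(n.*2.+1, n))%N.
    by rewrite -bin_sub; [congr ('C(_, _))|]; lia.
  rewrite doubleS /= in h1; rewrite /= h3 in h2; rewrite doubleS -h1.
  nia.
have n1 : (0 < n.+1 ^ 2)%N by [].
rewrite -(leq_pmul2l n1) (expnS 16).
have -> : (n.+1 ^ 2 * ((4 * n.+1 + 1) * 'C(n.+1.*2, n.+1) ^ 2) =
  (4 * n.+1 + 1) * (n.+1 * 'C(n.+1.*2, n.+1)) ^ 2)%N by ring.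
rewrite e1 !expnMn.
have h : (n.+1 ^ 2 * 16 * (4 * n + 1) <= (4 * n.+1 + 1) * (2 ^ 2 * (2 * n + 1) ^ 2))%N by nia.
apply: leq_trans (_ : n.+1 ^ 2 * 16 * ((4 * n + 1) * 'C(n.*2, n) ^ 2) <= _)%N.
  by rewrite mulnA; apply: leq_mul.
by rewrite mulnA (mulnA (4 * n.+1 + 1)) leq_mul2r h orbT.
Qed.

Lemma half_binomial_ge m : (4 ^ m <= 4 * m.+1 * 'C(m, m./2) ^ 2)%N.
Proof.
have [n [->|->]] : exists n, m = n.*2 \/ m = n.*2.+1.
  by exists m./2; lia.
  rewrite doubleK -{1}mul2n expnM; apply: leq_trans (central_binomial_ge n) _.
  by rewrite leq_mul2r -mul2n; lia.
have := central_binomial_ge n.+1.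
have h1 := mul_bin_diag n.+1.*2 n; rewrite doubleS /= in h1.
have h : ('C(n.*2.+2, n.+1) = 2 * 'C(n.*2.+1, n))%N by nia.
have -> : n.*2.+1./2 = n by lia.
have -> : (16 ^ n.+1 = 4 * 4 ^ n.*2.+1)%N.
  by rewrite -expnS -doubleS -mul2n expnM.
rewrite doubleS h expnMn; move: (4 ^ _)%N ('C(_, _) ^ 2)%N => x y; nia.
Qed.

(** A block of dimension k costs an amplitude of order sqrt k only. *)
Lemma Gamma_sqr_le (R : realType) k : (0 < k)%N -> Gamma k ^+ 2 <= 4 * k%:R :> R.
Proof.
case: k => // m _; rewrite /Gamma /= expr_div_n.
have b0 : (0 < 'C(m, m./2))%N by rewrite bin_gt0; lia.
rewrite ler_pdivrMr; last by rewrite exprn_gt0// ltr0n.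
rewrite -exprM mulnC exprM -natrX -[X in X <= _]natrX -[X in _ <= _ * X]natrX -!natrM ler_nat.
exact: half_binomial_ge.
Qed.

(** * The joint law of all blocks *)

Lemma prod_sum_fprod (R : comPzSemiRingType) (I : finType) (T_ : I -> finType)
    (F : forall i, T_ i -> R) :
  \prod_i \sum_(x : T_ i) F i x = \sum_(t : fprod T_) \prod_i F i (t i).
Proof.
pose P_ i : {ffun T_ i -> R} := [ffun x => F i x].
transitivity (\sum_(t : fprod T_) \prod_i P_ i (t i)); last first.
  by apply: eq_bigr => t _; apply: eq_bigr => i _; rewrite ffunE.
rewrite big_fprod -(bigA_distr_big_dep _ (fun i j => untag 0 (P_ i) j)).
apply: eq_bigr => i _; rewrite -(big_tag (fun i (x : T_ i) => P_ i x) i).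
by apply: eq_bigr => x _; rewrite ffunE.
Qed.

(** Restricting a pattern to the parts of a partition is a bijection onto the
    dependent product of the patterns of the parts, so that sums of products
    over the parts factorize. *)
Section blockwise.
Variables (R : comPzSemiRingType) (T I : finType) (P : I -> {set T}) (lev : T -> I).
Hypothesis levP : forall j i, (j \in P i) = (i == lev j).
Notation part i := {j : T | j \in P i}.

Let mem_lev j : j \in P (lev j). Proof. by rewrite levP. Qed.

Let split_parts (z : {ffun T -> bool}) : fprod (fun i => {ffun part i -> bool} : finType) :=
  fprod_of_fun (fun i => [ffun j : part i => z (val j)]).

Let join_parts (t : fprod (fun i => {ffun part i -> bool} : finType)) : {ffun T -> bool} :=
  [ffun j => t (lev j) (Sub j (mem_lev j))].

Let split_partsK : cancel split_parts join_parts.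
Proof. by move=> z; apply/ffunP => j; rewrite ffunE fprodE ffunE. Qed.

Let join_partsK : cancel join_parts split_parts.
Proof.
move=> t; apply/fprodP => i; rewrite fprodE; apply/ffunP => k; rewrite !ffunE.
have : i = lev (val k) by apply/eqP; rewrite -levP; exact: valP.
move: (mem_lev _) => /= p e; case: _ / e in p *.
by congr (fun_of_fin _ _); exact: val_inj.
Qed.

Lemma sum_prod_blocks (G : forall i, {ffun part i -> bool} -> R) :
  \sum_(z : {ffun T -> bool}) \prod_i G i [ffun j : part i => z (val j)] =
  \prod_i \sum_(y : {ffun part i -> bool}) G i y.
Proof.
rewrite prod_sum_fprod (reindex split_parts)/=; last first.
  by exists join_parts => z _; [exact: split_partsK|exact: join_partsK].
by apply: eq_bigr => z _; apply: eq_bigr => i _; rewrite fprodE.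
Qed.
End blockwise.

Section mechanism.
Context {R : realType} (d L : nat) (al : mlevel d L -> R).
Hypothesis al_gt0 : forall l, 0 < al l.
Implicit Types (x : d.-tuple R) (j : mindex d L).

Lemma rounding_bound_gt0 : 0 < rounding_bound d :> R.
Proof. by rewrite powR_gt0. Qed.

Let card_part (l : mlevel d L) : #|{: {j : mindex d L | j \in block l}}| = block_dim l.
Proof. by rewrite card_sig -card_block; apply: eq_card. Qed.

Let part_gt0 (l : mlevel d L) : (0 < #|{: {j : mindex d L | j \in block l}}|)%N.
Proof. by rewrite card_part prodn_gt0// => m; rewrite expn_gt0. Qed.

Lemma sum_mechanism_pmf x : \sum_z mechanism_pmf al x z = 1.
Proof.
rewrite (@sum_prod_blocks _ _ _ _ _ (@mem_block d L)
  (fun l y => block_pmf (rounding_bound d) (al l) (fun k => fourier (freq (val k)) x) y)).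
rewrite big1// => l _; apply: sum_block_pmf => //; exact: rounding_bound_gt0.
Qed.

(** All blocks other than that of [j] integrate to one. *)
Lemma mechanism_unbiased x j :
  \sum_z mechanism_pmf al x z * released al z j = fourier (freq j) x.
Proof.
pose G l (y : {ffun {k | k \in block l} -> bool}) :=
  block_pmf (rounding_bound d) (al l) (fun k => fourier (freq (val k)) x) y.
pose b l := amplitude (rounding_bound d) (al l) (block_dim l).
(* [insub j] is [None] in every block that does not contain [j] *)
pose G' l (y : {ffun {k | k \in block l} -> bool}) :=
  G l y * oapp (fun k => signed (b l) (y k)) 1 (insub j).
transitivity (\sum_(z : {ffun mindex d L -> bool})
    \prod_l G' l [ffun k : {k | k \in block l} => z (val k)]).
  apply: eq_bigr => z _; rewrite big_split; congr (_ * _).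
  rewrite (bigD1 (level_of j))//= insubT ?mem_block// => jl /=.
  rewrite ffunE big1 ?mulr1// => l nl.
  by rewrite insubF// mem_block (negbTE nl).
rewrite (sum_prod_blocks (@mem_block d L)) (bigD1 (level_of j))//= [X in _ * X]big1 ?mulr1.
  have jl : j \in block (level_of j) by rewrite mem_block.
  have := block_unbiased (fun k : {k | k \in block (level_of j)} => fourier (freq (val k)) x)
    rounding_bound_gt0 (al_gt0 (level_of j)) (part_gt0 _) (Sub j jl).
  rewrite SubK => <-; apply: eq_bigr => y _.
  by rewrite /G' /G insubT/= /b -card_part.
move=> l nl; rewrite -[RHS](sum_block_pmf (fun k : {k | k \in block l} => fourier (freq (val k)) x)
    rounding_bound_gt0 (al_gt0 l) (part_gt0 _)); apply: eq_bigr => y _.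
by rewrite /G' /G insubF ?mem_block ?(negbTE nl)//= mulr1.
Qed.

Lemma released_sqr z j :
  released al z j ^+ 2 =
  amplitude (rounding_bound d) (al (level_of j)) (block_dim (level_of j)) ^+ 2.
Proof. by rewrite /released /signed; case: (z j); rewrite ?sqrrN. Qed.
End mechanism.

(** * The variance of the empirical coefficients *)

Section sample_mean.
Variables (R : realType) (T : finType) (q : T -> R) (h : T -> R) (theta b : R) (n : nat).
Hypotheses (q1 : \sum_t q t = 1) (qh : \sum_t q t * h t = theta)
  (h2 : forall t, h t ^+ 2 = b) (n_gt0 : (0 < n)%N).

Lemma sum_prod_two (u v : T -> R) (i k : 'I_n) :
  \sum_(z : {ffun 'I_n -> T}) (\prod_i q (z i)) * (u (z i) * v (z k)) =
  if i == k then \sum_t q t * (u t * v t) else (\sum_t q t * u t) * (\sum_t q t * v t).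
Proof.
pose F (m : 'I_n) t := q t * ((if m == i then u t else 1) * (if m == k then v t else 1)).
transitivity (\sum_(z : {ffun 'I_n -> T}) \prod_m F m (z m)).
  apply: eq_bigr => z _; rewrite /F !big_split/= -!big_mkcond/=.
  by rewrite !big_pred1_eq.
rewrite -bigA_distr_bigA (bigD1 i)//=; have [ik|ik] := eqVneq i k.
  subst k.
  rewrite [X in _ * X]big1 ?mulr1 => [|m mi]; first by apply: eq_bigr => t _; rewrite /F eqxx.
  by under eq_bigr do rewrite /F (negbTE mi) !mulr1.
rewrite (bigD1 k) 1?eq_sym//= [X in _ * (_ * X)]big1 ?mulr1 => [|m /andP[mi mk]]; last first.
  by under eq_bigr do rewrite /F (negbTE mi) (negbTE mk) !mulr1.
congr (_ * _); apply: eq_bigr => t _; rewrite /F eqxx.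
  by rewrite (negbTE ik) mulr1.
by rewrite eq_sym (negbTE ik) mul1r.
Qed.

(** The products of distinct centred draws have mean zero; the squares of the
    released values are constant, so the variance of one draw is at most [b]. *)
Lemma sample_mean_variance :
  \sum_(z : {ffun 'I_n -> T}) (\prod_i q (z i)) * (n%:R^-1 * (\sum_i h (z i)) - theta) ^+ 2
  <= b / n%:R.
Proof.
have n0 : n%:R != 0 :> R by rewrite pnatr_eq0 -lt0n.
pose g t := h t - theta.
have qg : \sum_t q t * g t = 0.
  under eq_bigr do rewrite mulrBr.
  by rewrite sumrB -mulr_suml q1 qh mul1r subrr.
have qg2 : \sum_t q t * (g t * g t) = b - theta ^+ 2.
  rewrite (eq_bigr (fun t => b * q t - 2 * theta * (q t * h t) + theta ^+ 2 * q t)); last first.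
    by move=> t _; rewrite /g -(h2 t); ring.
  rewrite big_split sumrB/= -!mulr_sumr q1 qh; ring.
have E (z : {ffun 'I_n -> T}) : n%:R^-1 * (\sum_i h (z i)) - theta = n%:R^-1 * \sum_i g (z i).
  rewrite sumrB sumr_const card_ord mulrBr -[theta *+ n]mulr_natr; congr (_ - _).
  by rewrite mulrCA mulVf ?mulr1.
under eq_bigr do rewrite E exprMn mulrCA expr2 (expr2 (\sum_i _)) big_distrlr/= mulr_sumr.
rewrite -mulr_sumr exchange_big/=.
have -> : \sum_(i < n) \sum_(z : {ffun 'I_n -> T}) (\prod_i0 q (z i0)) * \sum_j g (z i) * g (z j)
   = \sum_(i < n) (b - theta ^+ 2).
  apply: eq_bigr => i _; under eq_bigr do rewrite mulr_sumr.
  rewrite exchange_big/= (bigD1 i)//= sum_prod_two eqxx qg2 big1 ?addr0// => k ki.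
  by rewrite sum_prod_two eq_sym (negbTE ki) qg mul0r.
rewrite sumr_const card_ord -[(_ - _) *+ n]mulr_natr.
rewrite [leLHS](_ : _ = (b - theta ^+ 2) / n%:R); last by field.
by apply: ler_wpM2r; [rewrite invr_ge0 ler0n|rewrite gerBl sqr_ge0].
Qed.
End sample_mean.

(** * The trigonometric system on the unit interval *)

Section trigonometric_integrals.
Context {R : realType}.
Notation lam := (@lebesgue_measure R).

Lemma cos2pi_nat n : cos (2 * pi * n%:R) = 1 :> R.
Proof.
elim: n => [|n IH]; first by rewrite mulr0 cos0.
by rewrite -[n.+1%:R]natr1 mulrDr mulr1 [2 * pi]mulr_natl cosD2pi -mulr_natl.
Qed.

Lemma sin2pi_nat n : sin (2 * pi * n%:R) = 0 :> R.
Proof.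
elim: n => [|n IH]; first by rewrite mulr0 sin0.
by rewrite -[n.+1%:R]natr1 mulrDr mulr1 [2 * pi]mulr_natl sinD2pi -mulr_natl.
Qed.

Lemma integral_trig_primitive (f F : R -> R) : continuous f ->
  (forall t : R, is_derive t (1 : R) F (f t)) -> F 0 = F 1 ->
  \int[lam]_(t in `[0, 1]) f t = 0.
Proof.
move=> cf dF F01.
have cF : continuous F.
  by move=> t; apply/differentiable_continuous/derivable1_diffP; case: (dF t).
rewrite /Rintegral (@continuous_FTC2 _ f F) ?ltr01//=.
- by rewrite F01 subrr.
- exact: continuous_subspaceT.
- split.
  + by move=> t _; case: (dF t).
  + exact/cvg_at_right_filter/cF.
  + exact/cvg_at_left_filter/cF.
- by move=> t _; rewrite derive1E; case: (dF t).
Qed.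

Lemma continuous_cosM (a : R) : continuous (fun t => cos (a * t)).
Proof.
move=> t; apply: (@continuous_comp _ _ _ (fun t => a * t) (@cos R)); last exact: continuous_cos.
exact: mulrl_continuous.
Qed.

Lemma continuous_sinM (a : R) : continuous (fun t => sin (a * t)).
Proof.
move=> t; apply: (@continuous_comp _ _ _ (fun t => a * t) (@sin R)); last exact: continuous_sin.
exact: mulrl_continuous.
Qed.

Lemma integral_cos_nat n : \int[lam]_(t in `[0, 1]) cos (2 * pi * n%:R * t) = (n == 0%N)%:R.
Proof.
have [->|n0] := eqVneq n 0%N.
  under eq_Rintegral do rewrite mulr0 mul0r cos0.
  rewrite Rintegral_cst//= (_ : lam _ = 1%E) ?mulr1//.
  by rewrite [LHS](lebesgue_measure_itv `[0, 1]) /= lte_fin ltr01 oppr0 adde0.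
set a := 2 * pi * n%:R.
have a0 : a != 0 by rewrite !mulf_neq0// ?pnatr_eq0// gt_eqF// pi_gt0.
apply: (@integral_trig_primitive _ (fun t => a^-1 * sin (a * t))).
- exact: continuous_cosM.
- by move=> t; apply: is_derive_eq; rewrite /GRing.scale/= mulr1 mulrCA mulVf// mulr1.
- by rewrite mulr0 sin0 mulr1 sin2pi_nat.
Qed.

Lemma integral_sin_nat n : \int[lam]_(t in `[0, 1]) sin (2 * pi * n%:R * t) = 0.
Proof.
have [->|n0] := eqVneq n 0%N.
  under eq_Rintegral do rewrite mulr0 mul0r sin0.
  by rewrite Rintegral_cst// mul0r.
set a := 2 * pi * n%:R.
have a0 : a != 0 by rewrite !mulf_neq0// ?pnatr_eq0// gt_eqF// pi_gt0.
apply: (@integral_trig_primitive _ (fun t => - a^-1 * cos (a * t))).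
- exact: continuous_sinM.
- move=> t; apply: is_derive_eq; rewrite /GRing.scale/= mulr1 [- sin _ * _]mulNr mulrNN.
  by rewrite mulrCA mulVf// mulr1.
- by rewrite mulr0 cos0 mulr1 cos2pi_nat.
Qed.

(** Frequencies are integers, so that sums and differences of frequencies stay in
    the family. *)
Definition cosw (n : nat) (t : R) : R := cos (2 * pi * n%:R * t).
Definition sinw (n : nat) (t : R) : R := sin (2 * pi * n%:R * t).

Lemma cosw0 t : cosw 0 t = 1. Proof. by rewrite /cosw mulr0 mul0r cos0. Qed.
Lemma sinw0 t : sinw 0 t = 0. Proof. by rewrite /sinw mulr0 mul0r sin0. Qed.

Lemma coswD m n t : cosw (m + n) t = cosw m t * cosw n t - sinw m t * sinw n t.
Proof. by rewrite /cosw natrD mulrDr mulrDl cosD. Qed.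

Lemma sinwD m n t : sinw (m + n) t = sinw m t * cosw n t + cosw m t * sinw n t.
Proof. by rewrite /sinw natrD mulrDr mulrDl sinD. Qed.

Lemma coswB m n t : (n <= m)%N -> cosw (m - n) t = cosw m t * cosw n t + sinw m t * sinw n t.
Proof. by move=> nm; rewrite /cosw natrB// mulrBr mulrBl cosB. Qed.

Lemma sinwB m n t : (n <= m)%N -> sinw (m - n) t = sinw m t * cosw n t - cosw m t * sinw n t.
Proof. by move=> nm; rewrite /sinw natrB// mulrBr mulrBl sinB. Qed.

Lemma continuous_cosw n : continuous (cosw n). Proof. exact: continuous_cosM. Qed.
Lemma continuous_sinw n : continuous (sinw n). Proof. exact: continuous_sinM. Qed.

Lemma unit_integrable (f : R -> R) : continuous f -> lam.-integrable `[0, 1] (EFin \o f).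
Proof.
move=> cf; apply: continuous_compact_integrable; first exact: segment_compact.
exact: continuous_subspaceT.
Qed.

Lemma continuousM_fun (f g : R -> R) : continuous f -> continuous g ->
  continuous (fun t => f t * g t).
Proof. by move=> cf cg t; apply: cvgM; [exact: cf|exact: cg]. Qed.

Let Iu (f : R -> R) := \int[lam]_(t in `[0, 1]) f t.

Let IuD f g : continuous f -> continuous g -> Iu (fun t => f t + g t) = Iu f + Iu g.
Proof. by move=> cf cg; apply: RintegralD => //; exact: unit_integrable. Qed.

Let IuB f g : continuous f -> continuous g -> Iu (fun t => f t - g t) = Iu f - Iu g.
Proof. by move=> cf cg; apply: RintegralB => //; exact: unit_integrable. Qed.

Lemma integral_cosw_cosw m n : (0 < m)%N ->
  \int[lam]_(t in `[0, 1]) (2 * (cosw m t * cosw n t)) = (m == n)%:R.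
Proof.
wlog nm : m n / (n <= m)%N.
  move=> H m0; have [nm|mn] := leqP n m; first exact: H.
  have [->|n0] := posnP n; last first.
    by rewrite eq_sym -H ?(ltnW mn)//; apply: eq_Rintegral => t _; rewrite [X in _ * X]mulrC.
  by rewrite H.
move=> m0; transitivity (Iu (fun t => cosw (m - n) t + cosw (m + n) t)).
  by apply: eq_Rintegral => t _; rewrite coswD coswB//; ring.
rewrite IuD; [|exact: continuous_cosw..].
rewrite /Iu !integral_cos_nat subn_eq0 addn_eq0 (gtn_eqF m0)/= addr0.
by rewrite eqn_leq nm andbT.
Qed.

Lemma integral_sinw_sinw m n : (0 < m)%N -> (0 < n)%N ->
  \int[lam]_(t in `[0, 1]) (2 * (sinw m t * sinw n t)) = (m == n)%:R.
Proof.
wlog nm : m n / (n <= m)%N.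
  move=> H m0 n0; have [nm|mn] := leqP n m; first exact: H.
  by rewrite eq_sym -H ?(ltnW mn)//; apply: eq_Rintegral => t _; rewrite [X in _ * X]mulrC.
move=> m0 n0; transitivity (Iu (fun t => cosw (m - n) t - cosw (m + n) t)).
  by apply: eq_Rintegral => t _; rewrite coswD coswB//; ring.
rewrite IuB; [|exact: continuous_cosw..].
rewrite /Iu !integral_cos_nat subn_eq0 addn_eq0 (gtn_eqF m0)/= subr0.
by rewrite eqn_leq nm andbT.
Qed.

Lemma integral_sinw_cosw m n :
  \int[lam]_(t in `[0, 1]) (2 * (sinw m t * cosw n t)) = 0.
Proof.
have [nm|/ltnW mn] := leqP n m.
  transitivity (Iu (fun t => sinw (m - n) t + sinw (m + n) t)).
    by apply: eq_Rintegral => t _; rewrite sinwD sinwB//; ring.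
  rewrite IuD; [|exact: continuous_sinw..].
  by rewrite /Iu !integral_sin_nat addr0.
transitivity (Iu (fun t => sinw (m + n) t - sinw (n - m) t)).
  by apply: eq_Rintegral => t _; rewrite sinwD sinwB//; ring.
rewrite IuB; [|exact: continuous_sinw..].
by rewrite /Iu !integral_sin_nat subr0.
Qed.

Lemma sqrt2M (x y : R) : Num.sqrt 2 * x * (Num.sqrt 2 * y) = 2 * (x * y).
Proof. by rewrite mulrACA -(expr2 (Num.sqrt 2)) sqr_sqrtr. Qed.

Lemma fourier1E j : fourier1 j =
  (if j == 1%N then fun=> 1 else if odd j then fun t => Num.sqrt 2 * sinw j./2 t
   else fun t => Num.sqrt 2 * cosw j./2 t) :> (R -> R).
Proof. by apply/funext => t; rewrite /fourier1; case: (j == 1%N) => //; case: (odd j). Qed.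

Lemma continuous_fourier1 j : continuous (@fourier1 R j).
Proof.
rewrite fourier1E; case: ifP => _; first by move=> t; exact: cst_continuous.
case: ifP => _.
  by apply: continuousM_fun; [move=> t; exact: cst_continuous|exact: continuous_sinw].
by apply: continuousM_fun; [move=> t; exact: cst_continuous|exact: continuous_cosw].
Qed.

Lemma fourier1_orthonormal j k : (0 < j)%N -> (0 < k)%N ->
  \int[lam]_(t in `[0, 1]) (fourier1 j t * fourier1 k t) = (j == k)%:R.
Proof.
have I1 k' : (1 < k')%N -> Iu (fourier1 k') = 0.
  move=> k1; rewrite fourier1E gtn_eqF//; case: ifP => ok; rewrite /Iu RintegralZl//;
    try (by apply: unit_integrable; first [exact: continuous_sinw|exact: continuous_cosw]).
    by rewrite integral_sin_nat mulr0.
  by rewrite integral_cos_nat (_ : (k'./2 == 0%N) = false) ?mulr0//; lia.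
move=> j0 k0; have [->|j1] := eqVneq j 1%N.
  under eq_Rintegral do rewrite [fourier1 1 _]/fourier1 eqxx mul1r.
  have [<-|k1] := eqVneq 1%N k; last by rewrite [LHS]I1//; lia.
  transitivity (Iu (cosw 0)); last by rewrite /Iu integral_cos_nat.
  by apply: eq_Rintegral => t _; rewrite cosw0 /fourier1 eqxx.
have [->|k1] := eqVneq k 1%N.
  under eq_Rintegral do rewrite [fourier1 1 _]/fourier1 eqxx mulr1.
  by rewrite (negbTE j1) [LHS]I1//; lia.
rewrite !fourier1E (negbTE j1) (negbTE k1).
case: ifP => oj; case: ifP => ok; under eq_Rintegral do rewrite sqrt2M.
- by rewrite integral_sinw_sinw; [congr (nat_of_bool _)%:R| |]; lia.
- by rewrite integral_sinw_cosw (_ : j == k = false)//; lia.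
- under eq_Rintegral do rewrite [X in _ * X]mulrC.
  by rewrite integral_sinw_cosw (_ : j == k = false)//; lia.
- by rewrite integral_cosw_cosw; [congr (nat_of_bool _)%:R|]; lia.
Qed.
End trigonometric_integrals.

(** * Integration on the unit cube *)

Section cube_integrals.
Context {R : realType}.
Implicit Type d : nat.
Notation lam := (@lebesgue_measure R).
Notation mu d := (@lebesgue_tuple R d).

Lemma cubeE d : cube d = [set x : d.-tuple R | forall m, `[0, 1]%classic (tnth x m)].
Proof. by []. Qed.

Lemma measurable_box d (A : 'I_d -> set R) : (forall m, measurable (A m)) ->
  measurable [set x : d.-tuple R | forall m, A m (tnth x m)].
Proof.
move=> mA; rewrite (_ : [set x | _] =
    \bigcap_(i in [set: 'I_d]) (@tnth d R ^~ i @^-1` A i)).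
  apply: fin_bigcap_measurable => [|i _]; first exact: finite_finset.
  by rewrite -[X in measurable X]setTI; exact: measurable_tnth.
by apply/seteqP; split => x /= H i; [move=> _|]; exact: H.
Qed.

Lemma measurable_cube d : measurable (cube d : set (d.-tuple R)).
Proof. by rewrite cubeE; apply: (@measurable_box d (fun=> `[0, 1]%classic)). Qed.
#[local] Hint Extern 0 (measurable (cube _)) => (exact: measurable_cube) : core.

Lemma unit_measure1 : lam `[0, 1] = 1%E.
Proof. by rewrite [LHS](lebesgue_measure_itv `[0, 1]) /= lte_fin ltr01 oppr0 adde0. Qed.

Lemma cube_measure1 d : mu d (cube d) = 1%E.
Proof.
by rewrite cubeE (@lebesgue_tuple_box _ d (fun=> `[0, 1]%classic))// big1// => m _; exact: unit_measure1.
Qed.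

(** A class of integrands closed under all ring operations, large enough for the
    trigonometric polynomials and for the probabilities of the mechanism. *)
Definition bounded_on_cube d (F : d.-tuple R -> R) :=
  measurable_fun setT F /\ exists M, forall x, cube d x -> `|F x| <= M.

Lemma bounded_on_cube_integrable d (F : d.-tuple R -> R) :
  bounded_on_cube F -> (mu d).-integrable (cube d) (EFin \o F).
Proof.
move=> [mF [M FM]]; apply: measurable_bounded_integrable => //.
- by rewrite [ltLHS]cube_measure1 ltry.
- exact: measurable_funTS.
- exists M; split; first exact: num_real.
  by move=> t Mt x Dx; apply: le_trans (FM _ Dx) (ltW Mt).
Qed.

Lemma bounded_on_cube_cst d (a : R) : bounded_on_cube (fun _ : d.-tuple R => a).
Proof. by split; [exact: measurable_cst|exists `|a|]. Qed.

Lemma bounded_on_cubeD d (F G : d.-tuple R -> R) : bounded_on_cube F -> bounded_on_cube G ->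
  bounded_on_cube (fun x => F x + G x).
Proof.
move=> [mF [M FM]] [mG [N GN]]; split; first exact: measurable_funD.
exists (M + N) => x Dx; apply: le_trans (ler_normD _ _) _.
by apply: lerD; [exact: FM|exact: GN].
Qed.

Lemma bounded_on_cubeM d (F G : d.-tuple R -> R) : bounded_on_cube F -> bounded_on_cube G ->
  bounded_on_cube (fun x => F x * G x).
Proof.
move=> [mF [M FM]] [mG [N GN]]; split; first exact: measurable_funM.
exists (M * N) => x Dx; rewrite normrM.
by apply: ler_pM => //; [exact: FM|exact: GN].
Qed.

Lemma bounded_on_cube_sum d I (s : seq I) (F : I -> d.-tuple R -> R) :
  (forall i, bounded_on_cube (F i)) -> bounded_on_cube (fun x => \sum_(i <- s) F i x).
Proof.
move=> bF; elim: s => [|i s IH].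
  by under eq_fun do rewrite big_nil; exact: bounded_on_cube_cst.
by under eq_fun do rewrite big_cons; exact: bounded_on_cubeD.
Qed.

Lemma bounded_on_cube_prod d I (s : seq I) (F : I -> d.-tuple R -> R) :
  (forall i, bounded_on_cube (F i)) -> bounded_on_cube (fun x => \prod_(i <- s) F i x).
Proof.
move=> bF; elim: s => [|i s IH].
  by under eq_fun do rewrite big_nil; exact: bounded_on_cube_cst.
by under eq_fun do rewrite big_cons; exact: bounded_on_cubeM.
Qed.

Lemma bounded_on_cube_tnth d (m : 'I_d) (h : R -> R) : measurable_fun setT h ->
  (exists M, forall t, t \in `[0, 1] -> `|h t| <= M) ->
  bounded_on_cube (fun x => h (tnth x m)).
Proof.
move=> mh [M hM]; split; last by exists M => x Dx; exact/hM/Dx.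
by apply: measurableT_comp => //; exact: measurable_tnth.
Qed.

Lemma bounded_on_cube_continuous d (m : 'I_d) (h : R -> R) : continuous h ->
  bounded_on_cube (fun x => h (tnth x m)).
Proof.
move=> ch; apply: bounded_on_cube_tnth; first exact: continuous_measurable_fun.
have [M [_ hM]] : bounded_set (h @` `[0, 1]).
  apply: compact_bounded; apply: continuous_compact; last exact: segment_compact.
  exact: continuous_subspaceT.
exists (M + 1) => t t01; apply: hM; first by rewrite ltrDl.
by exists t.
Qed.

(** Fubini for one splitting of a coordinate.  Restricting both factors to the
    unit interval and to the cube turns the integral into one over the whole
    product space. *)
Lemma integral_cons d (h : R -> R) (F : d.-tuple R -> R) :
  measurable_fun setT h -> lam.-integrable `[0, 1] (EFin \o h) -> bounded_on_cube F ->
  (exists M, forall t, t \in `[0, 1] -> `|h t| <= M) ->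
  \int[mu d.+1]_(x in cube d.+1) (h (thead x) * F [tuple of behead x]) =
  (\int[lam]_(t in `[0, 1]) h t) * \int[mu d]_(x in cube d) F x.
Proof.
move=> mh ih bF [M hM]; have [mF [N FN]] := bF.
pose h' := h \_ `[0, 1]; pose F' := F \_ (cube d).
have mh' : measurable_fun setT h'.
  by rewrite /h' -measurable_restrictT//; exact: measurable_funTS.
have mF' : measurable_fun setT F'.
  by rewrite /F' -measurable_restrictT//; exact: measurable_funTS.
have h'M t : `|h' t| <= `|M|.
  rewrite /h' patchE; case: ifPn => [/set_mem t01|_]; last by rewrite normr0.
  exact: le_trans (hM _ t01) (ler_norm _).
have F'N x : `|F' x| <= `|N|.
  rewrite /F' patchE; case: ifPn => [/set_mem Dx|_]; last by rewrite normr0.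
  exact: le_trans (FN _ Dx) (ler_norm _).
pose K (p : R * d.-tuple R) := (h' p.1 * F' p.2).
have mK : measurable_fun setT K.
  apply: measurable_funM.
    exact: (measurableT_comp mh' measurable_fst).
  exact: (measurableT_comp mF' measurable_snd).
have iK : (lam \x mu d)%E.-integrable setT (EFin \o K).
  have mP : measurable (`[0, 1]%classic `*` cube d : set (R * d.-tuple R)).
    exact: measurableX.
  rewrite (_ : _ \o _ = (EFin \o K) \_ (`[0, 1]%classic `*` cube d)).
    apply/integrable_restrict => //; rewrite setTI.
    apply: measurable_bounded_integrable => //.
    - pose U : set R := `[0, 1]%classic.
      have PE : ((lam \x mu d) (U `*` cube d) = lam U * mu d (cube d))%E.
        by apply: product_measure1E => //; exact: measurable_itv.
      by rewrite [ltLHS]PE unit_measure1 cube_measure1 mule1 ltry.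
    - exact: measurable_funTS.
    - exists (`|M| * `|N|); split; first exact: num_real.
      by move=> u Mu p _; apply: le_trans (ltW Mu); rewrite normrM ler_pM.
  apply/funext => -[a t]; rewrite patchE /K/=; case: ifPn => // /negP nP.
  congr EFin; rewrite /h' /F' !patchE; case: ifPn => [a01|_]; last by rewrite mul0r.
  case: ifPn => [Dt|_]; last by rewrite mulr0.
  by exfalso; apply: nP; rewrite inE; split; exact: set_mem.
transitivity (fine (\int[(lam \x mu d)%E]_p (K p)%:E)%E).
  rewrite /Rintegral; congr fine.
  rewrite integral_mkcond/=.
  pose G (x : d.+1.-tuple R) := (K (unconsT x))%:E.
  have GE : G \o @consT R d = EFin \o K by apply/funext => p; rewrite /G/= consTK.
  rewrite (eq_integral G); last first.
    move=> x _; rewrite patchE /G /K /= /h' /F' !patchE; case: ifPn => [/set_mem Dx|nDx].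
      rewrite !mem_set//.
        by move=> m; have := Dx (lift ord0 m); rewrite [in X in X -> _](tuple_eta x) tnthS.
      by have := Dx ord0; rewrite /= /thead.
    case: ifPn => [/set_mem x0|_]; last by rewrite mul0r.
    case: ifPn => [/set_mem xS|_]; last by rewrite mulr0.
    exfalso; move/negP: nDx; apply; rewrite inE => m.
    case: (unliftP ord0 m) => [j ->|->]; last exact: x0.
    by rewrite (tuple_eta x) tnthS; exact: xS.
  transitivity (\int[pushforward (lam \x mu d)%E (@consT R d)]_x G x)%E; first by [].
  rewrite integral_pushforward.
  - by rewrite preimage_setT GE.
  - exact: measurable_consT.
  - apply/measurable_EFinP; apply: measurableT_comp => //; exact: measurable_unconsT.
  - by rewrite preimage_setT GE.
  - exact: measurableT.
rewrite -integral12_prod_meas1//.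
have iF' : (mu d).-integrable setT (EFin \o F').
  rewrite /F' -restrict_EFin; apply/integrable_restrict => //; rewrite setTI.
  exact: bounded_on_cube_integrable.
have ih' : lam.-integrable setT (EFin \o h').
  by rewrite /h' -restrict_EFin; apply/integrable_restrict => //; rewrite setTI.
set c := \int[mu d]_(x in cube d) F x.
transitivity (\int[lam]_t (h' t * c)).
  congr fine; apply: eq_integral => t _; rewrite /fubini_F /K/=.
  under eq_integral do rewrite EFinM.
  rewrite integralZl// EFinM; congr (_ * _)%E.
  by rewrite /c Rintegral_mkcond fineK//; exact: integrable_fin_num.
by rewrite RintegralZr// [in RHS]Rintegral_mkcond.
Qed.

Lemma integral_prod d (h : 'I_d -> R -> R) : (forall m, continuous (h m)) ->
  \int[mu d]_(x in cube d) \prod_(m < d) h m (tnth x m) =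
  \prod_(m < d) \int[lam]_(t in `[0, 1]) h m t.
Proof.
elim: d h => [|d IH] h ch.
  under eq_Rintegral do rewrite big_ord0.
  by rewrite Rintegral_cst// big_ord0 mul1r [X in fine X]cube_measure1.
rewrite big_ord_recl -(IH (fun m => h (lift ord0 m)))//.
rewrite -integral_cons.
- apply: eq_Rintegral => x _; rewrite big_ord_recl; congr (_ * _).
  by apply: eq_bigr => m _; rewrite [in LHS](tuple_eta x) tnthS.
- exact: continuous_measurable_fun.
- exact: unit_integrable.
- by apply: bounded_on_cube_prod => m; exact: bounded_on_cube_continuous.
- have [M [_ hM]] : bounded_set (h ord0 @` `[0, 1]).
    apply: compact_bounded; apply: continuous_compact; last exact: segment_compact.
    exact: continuous_subspaceT.
  exists (M + 1) => t t01; apply: hM; first by rewrite ltrDl.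
  by exists t.
Qed.

Lemma bounded_on_cube_fourier d (j : {ffun 'I_d -> nat}) : bounded_on_cube (@fourier R d j).
Proof.
apply: bounded_on_cube_prod => m; apply: bounded_on_cube_continuous.
exact: continuous_fourier1.
Qed.

Lemma fourier_orthonormal d (j k : {ffun 'I_d -> nat}) :
  (forall m, 0 < j m)%N -> (forall m, 0 < k m)%N ->
  \int[mu d]_(x in cube d) (fourier j x * fourier k x) = (j == k)%:R.
Proof.
move=> j0 k0.
under eq_Rintegral do rewrite /fourier -big_split/=.
rewrite (@integral_prod d (fun m t => fourier1 (j m) t * fourier1 (k m) t)); last first.
  by move=> m; apply: continuousM_fun; exact: continuous_fourier1.
have [->|jk] := eqVneq j k.
  by apply: big1 => m _; rewrite fourier1_orthonormal// eqxx.
have [m jkm] : exists m, j m != k m.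
  by apply/existsP; rewrite -negb_forall; apply: contra jk => /forallP e; apply/eqP/ffunP => m; apply/eqP.
by rewrite (bigD1 m)//= fourier1_orthonormal// (negbTE jkm) mul0r.
Qed.
End cube_integrals.
#[global] Hint Extern 0 (measurable (cube _)) => (exact: measurable_cube) : core.

(** * Square integrable functions on the cube *)

Section l2.
Context {R : realType} (d : nat).
Notation mu := (@lebesgue_tuple R d).
Notation C := (cube d : set (d.-tuple R)).
Notation fn := (d.-tuple R -> R).
Implicit Types (f g h : fn).

(** The scalar product of L2, on functions rather than on classes; linearity then
    requires square integrability of each argument. *)
Definition ip f g : R := \int[mu]_(x in C) (f x * g x).

Lemma sqint_mul f g : square_integrable f -> square_integrable g ->
  mu.-integrable C (EFin \o (fun x => f x * g x)).
Proof.
move=> [mf f2] [mg g2].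
have i2 : mu.-integrable C (EFin \o (fun x => f x ^+ 2 + g x ^+ 2)).
  by have := integrableD (@measurable_cube R d) f2 g2.
apply: le_integrable i2 => //.
  by apply/measurable_EFinP; exact: measurable_funM.
move=> x _ /=; rewrite lee_fin [leRHS]ger0_norm; last by rewrite addr_ge0// sqr_ge0.
rewrite normrM -(real_normK (num_real (f x))) -(real_normK (num_real (g x))).
have := sqr_ge0 (`|f x| - `|g x|); have := mulr_ge0 (normr_ge0 (f x)) (normr_ge0 (g x)).
by nra.
Qed.

Lemma sqint_bounded f : bounded_on_cube f -> square_integrable f.
Proof.
move=> bf; split; first exact: measurable_funTS bf.1.
exact: bounded_on_cube_integrable (bounded_on_cubeM bf bf).
Qed.

Lemma sqintD f g : square_integrable f -> square_integrable g ->
  square_integrable (fun x => f x + g x).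
Proof.
move=> sf sg; split; first exact: measurable_funD sf.1 sg.1.
have -> : (fun x => ((f x + g x) ^+ 2)%:E) =
    (fun x => ((EFin \o (fun x => f x * f x)%R) x + ((EFin \o (fun x => f x * g x)%R) x +
      ((EFin \o (fun x => f x * g x)%R) x + (EFin \o (fun x => g x * g x)%R) x)))%E).
  by apply/funext => x /=; rewrite -!EFinD; congr EFin; ring.
by do 3! (apply: integrableD => //; first exact: sqint_mul); exact: sqint_mul.
Qed.

Lemma sqintZ a f : square_integrable f -> square_integrable (fun x => a * f x).
Proof.
move=> sf; split; first by apply: measurable_funM; [exact: measurable_cst|exact: sf.1].
have -> : (fun x => ((a * f x) ^+ 2)%:E) =
    (fun x => (a ^+ 2)%:E * (EFin \o (fun x => f x * f x)%R) x)%E.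
  by apply/funext => x /=; rewrite -EFinM; congr EFin; ring.
by apply: integrableZl => //; exact: sqint_mul.
Qed.

Lemma sqintB f g : square_integrable f -> square_integrable g ->
  square_integrable (fun x => f x - g x).
Proof.
move=> sf sg; have := sqintD sf (sqintZ (-1) sg).
by under eq_fun do rewrite mulN1r.
Qed.

Lemma sqint_sum I (s : seq I) (F : I -> fn) : (forall i, square_integrable (F i)) ->
  square_integrable (fun x => \sum_(i <- s) F i x).
Proof.
move=> sF; elim: s => [|i s IH].
  under eq_fun do rewrite big_nil.
  by apply: sqint_bounded; exact: bounded_on_cube_cst.
by under eq_fun do rewrite big_cons; exact: sqintD.
Qed.

Lemma sqint_fourier j : square_integrable (@fourier R d j).
Proof. by apply: sqint_bounded; exact: bounded_on_cube_fourier. Qed.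

Lemma ipC f g : ip f g = ip g f.
Proof. by apply: eq_Rintegral => x _; rewrite mulrC. Qed.

Lemma eq_ip f f' g g' : (forall x, C x -> f x = f' x) -> (forall x, C x -> g x = g' x) ->
  ip f g = ip f' g'.
Proof. by move=> ff gg; apply: eq_Rintegral => x /set_mem Dx; rewrite ff ?gg. Qed.

Lemma ip_ge0 f : 0 <= ip f f.
Proof. by apply: Rintegral_ge0 => x _; rewrite -expr2 sqr_ge0. Qed.

Lemma ipDl f g h : square_integrable f -> square_integrable g -> square_integrable h ->
  ip (fun x => f x + g x) h = ip f h + ip g h.
Proof.
move=> sf sg sh; rewrite /ip -RintegralD//; try exact: sqint_mul.
by apply: eq_Rintegral => x _; rewrite mulrDl.
Qed.

Lemma ipZl a f g : square_integrable f -> square_integrable g ->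
  ip (fun x => a * f x) g = a * ip f g.
Proof.
move=> sf sg; rewrite /ip -RintegralZl//; last exact: sqint_mul.
by apply: eq_Rintegral => x _; rewrite mulrA.
Qed.

Lemma ipBl f g h : square_integrable f -> square_integrable g -> square_integrable h ->
  ip (fun x => f x - g x) h = ip f h - ip g h.
Proof.
move=> sf sg sh; rewrite -mulN1r -ipZl// -ipDl//; last exact: sqintZ.
by apply: eq_ip => // x _; rewrite mulN1r.
Qed.

Lemma ip_suml I (s : seq I) (F : I -> fn) g : (forall i, square_integrable (F i)) ->
  square_integrable g -> ip (fun x => \sum_(i <- s) F i x) g = \sum_(i <- s) ip (F i) g.
Proof.
move=> sF sg; elim: s => [|i s IH].
  rewrite big_nil -[RHS](mul0r (ip g g)) -ipZl//.
  by apply: eq_ip => // x _; rewrite big_nil mul0r.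
rewrite big_cons -IH -ipDl//; last exact: sqint_sum.
by apply: eq_ip => // x _; rewrite big_cons.
Qed.

Lemma ip_sqrD f g : square_integrable f -> square_integrable g ->
  ip (fun x => f x + g x) (fun x => f x + g x) = ip f f + 2 * ip f g + ip g g.
Proof.
move=> sf sg; have sfg := sqintD sf sg.
rewrite ipDl// (ipC f) (ipC g) !ipDl// (ipC g f); ring.
Qed.

(** The quadratic polynomial [t |-> ip (f + t g) (f + t g)] is nonnegative. *)
Lemma cauchy_schwarz f g : square_integrable f -> square_integrable g ->
  ip f g ^+ 2 <= ip f f * ip g g.
Proof.
move=> sf sg.
have H t : 0 <= ip f f + 2 * t * ip f g + t ^+ 2 * ip g g.
  have := ip_ge0 (fun x => f x + t * g x).
  have stg := sqintZ t sg.
  rewrite ip_sqrD// ipZl// (ipC g) ipZl// (ipC f) ipZl// (ipC g f).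
  by congr (_ <= _); ring.
have f0 := ip_ge0 f; have g0 := ip_ge0 g.
have [gg|gg] := eqVneq (ip g g) 0.
  rewrite gg mulr0; have [->|fg] := eqVneq (ip f g) 0; first by rewrite expr0n.
  exfalso; have := H (- (ip f f + 1) / (2 * ip f g)); rewrite gg mulr0 addr0.
  have -> : 2 * (- (ip f f + 1) / (2 * ip f g)) * ip f g = - (ip f f + 1) by field.
  lra.
have := H (- ip f g / ip g g).
have gp : 0 < ip g g by rewrite lt_def gg.
rewrite -(pmulr_rge0 _ gp).
rewrite (_ : ip g g * _ = ip f f * ip g g - ip f g ^+ 2); last by field.
by rewrite subr_ge0.
Qed.

(** ** Fourier projections *)

Implicit Types (j k : {ffun 'I_d -> nat}) (s : seq {ffun 'I_d -> nat}).

Definition positive_freq j := [forall m, 0 < j m]%N.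

Definition projection s f : fn := fun x => \sum_(j <- s) fourier_coef f j * fourier j x.

Lemma ip_fourier f j : ip f (fourier j) = fourier_coef f j. Proof. by []. Qed.

Lemma sqint_projection s f : square_integrable (projection s f).
Proof. by apply: sqint_sum => j; apply/sqintZ/sqint_fourier. Qed.

Lemma ip_fourier_fourier j k : positive_freq j -> positive_freq k ->
  ip (fourier j) (fourier k) = (j == k)%:R.
Proof. by move=> /forallP j0 /forallP k0; exact: fourier_orthonormal. Qed.

Lemma projection_coef s f k : uniq s -> all positive_freq s -> positive_freq k ->
  ip (projection s f) (fourier k) = if k \in s then fourier_coef f k else 0.
Proof.
move=> us /allP ps pk.
rewrite ip_suml; [|by move=> j; apply/sqintZ/sqint_fourier|exact: sqint_fourier].
rewrite big_seq_cond.
rewrite (eq_bigr (fun j => if j == k then fourier_coef f j else 0)); last first.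
  move=> j /andP[js _]; rewrite ipZl ?ip_fourier_fourier; [|exact: ps|by []|exact: sqint_fourier..].
  by case: eqP => _; rewrite ?mulr1 ?mulr0.
rewrite -big_seq_cond -big_mkcond.
case: ifPn => ks; last first.
  by rewrite big_seq_cond big1// => j /andP[js /eqP jk]; move: ks; rewrite -jk js.
by rewrite (big_rem k)//= eqxx big_seq_cond big1 ?addr0// => j /andP[+ /eqP jk];
  rewrite jk mem_rem_uniq// !inE eqxx.
Qed.

(** A trigonometric polynomial is given by its list of coefficients and
    frequencies; repetitions are allowed so that sums are concatenations. *)
Definition trig_sum (l : seq (R * {ffun 'I_d -> nat})) : fn :=
  fun x => \sum_(u <- l) u.1 * fourier u.2 x.

Lemma sqint_trig_sum l : square_integrable (trig_sum l).
Proof. by apply: sqint_sum => j; apply/sqintZ/sqint_fourier. Qed.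

Lemma ip_trig_sum f l : square_integrable f ->
  ip f (trig_sum l) = \sum_(u <- l) u.1 * fourier_coef f u.2.
Proof.
move=> sf; rewrite ipC ip_suml//; last by move=> j; apply/sqintZ/sqint_fourier.
apply: eq_bigr => u _; rewrite ipZl//; last exact: sqint_fourier.
by rewrite ipC ip_fourier.
Qed.

Lemma projection_orthogonal s f l : uniq s -> all positive_freq s -> square_integrable f ->
  {subset map snd l <= s} -> ip (fun x => f x - projection s f x) (trig_sum l) = 0.
Proof.
move=> us ps sf ls; have sp := sqint_projection s f.
rewrite ip_trig_sum; last exact: sqintB.
rewrite big_seq big1// => u ul; have us2 : u.2 \in s by apply: ls; exact: map_f.
have sk := sqint_fourier u.2.
rewrite -ip_fourier ipBl// projection_coef//; last by move/allP: ps; exact.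
by rewrite us2 ip_fourier subrr mulr0.
Qed.

Lemma projectionE s f : projection s f = trig_sum [seq (fourier_coef f j, j) | j <- s].
Proof. by apply/funext => x; rewrite /trig_sum big_map. Qed.

(** Pythagoras: the residual is orthogonal to every trigonometric sum with
    frequencies in [s]. *)
Lemma projection_best s f l : uniq s -> all positive_freq s -> square_integrable f ->
  {subset map snd l <= s} ->
  ip (fun x => f x - projection s f x) (fun x => f x - projection s f x) <=
  ip (fun x => f x - trig_sum l x) (fun x => f x - trig_sum l x).
Proof.
move=> us ps sf ls.
have sp := sqint_projection s f; have st := sqint_trig_sum l.
pose h x := f x - projection s f x; pose q x := projection s f x - trig_sum l x.
have sh : square_integrable h by exact: sqintB.
have sq : square_integrable q by exact: sqintB.
have -> : (fun x => f x - trig_sum l x) = (fun x => h x + q x).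
  by apply/funext => x; rewrite /h /q; ring.
suff hq : ip h q = 0 by rewrite (@ip_sqrD h q)// hq mulr0 addr0 lerDl ip_ge0.
rewrite ipC ipBl// ipC (ipC _ h) projection_orthogonal// subr0.
rewrite projectionE projection_orthogonal//.
by rewrite -map_comp map_id.
Qed.

Lemma ip_projection_tail s t f g : uniq s -> all positive_freq s -> uniq t ->
  all positive_freq t -> square_integrable f ->
  ip (fun x => f x - projection s f x) (projection t g) =
  \sum_(k <- t | k \notin s) fourier_coef f k * fourier_coef g k.
Proof.
move=> us ps ut /allP pt sf; have sp := sqint_projection s f.
rewrite (projectionE t) ip_trig_sum; last exact: sqintB.
rewrite big_map [RHS]big_mkcond/= big_seq [RHS]big_seq; apply: eq_bigr => k kt.
have sk := sqint_fourier k.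
rewrite /= -[fourier_coef (fun _ => _ - _) _]ip_fourier ipBl// projection_coef//; last exact: pt.
by rewrite ip_fourier; case: (k \in s) => /=; rewrite ?subrr ?mulr0// subr0 mulrC.
Qed.
End l2.
#[global] Arguments positive_freq {d} j.

(** * Completeness of the trigonometric system *)

Section one_dimension.
Context {R : realType}.
Implicit Types (p q : R -> R) (A B : set R).

(** One-dimensional trigonometric polynomials, as a closure: this makes the
    product formulas the only computation behind stability under products. *)
Inductive trig1 : (R -> R) -> Prop :=
| trig1_cos n : trig1 (cosw n)
| trig1_sin n : trig1 (sinw n)
| trig1_lin a p q : trig1 p -> trig1 q -> trig1 (fun t => a * p t + q t).

Lemma trig1_ext p q : p =1 q -> trig1 p -> trig1 q.
Proof. by move=> /funext ->. Qed.

Lemma trig1_0 : trig1 (fun=> 0).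
Proof.
by apply: (trig1_ext _ (trig1_lin (-1) (trig1_cos 0) (trig1_cos 0))) => t; ring.
Qed.

Lemma trig1_Z a p : trig1 p -> trig1 (fun t => a * p t).
Proof. by move=> tp; apply: (trig1_ext _ (trig1_lin a tp trig1_0)) => t; rewrite addr0. Qed.

Lemma trig1_D p q : trig1 p -> trig1 q -> trig1 (fun t => p t + q t).
Proof. by move=> tp tq; apply: (trig1_ext _ (trig1_lin 1 tp tq)) => t; rewrite mul1r. Qed.

Lemma trig1_cst a : trig1 (fun=> a).
Proof. by apply: (trig1_ext _ (trig1_Z a (trig1_cos 0))) => t; rewrite cosw0 mulr1. Qed.

Lemma trig1_cos_cos m n : trig1 (fun t => cosw m t * cosw n t).
Proof.
wlog nm : m n / (n <= m)%N.
  move=> H; have [nm|/ltnW mn] := leqP n m; first exact: H.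
  by apply: (trig1_ext _ (H n m mn)) => t; rewrite mulrC.
apply: (trig1_ext _ (trig1_Z (1 / 2) (trig1_D (trig1_cos (m - n)) (trig1_cos (m + n))))) => t.
by rewrite coswB// coswD; field.
Qed.

Lemma trig1_sin_sin m n : trig1 (fun t => sinw m t * sinw n t).
Proof.
wlog nm : m n / (n <= m)%N.
  move=> H; have [nm|/ltnW mn] := leqP n m; first exact: H.
  by apply: (trig1_ext _ (H n m mn)) => t; rewrite mulrC.
apply: (trig1_ext _ (trig1_Z (1 / 2)
  (trig1_lin (-1) (trig1_cos (m + n)) (trig1_cos (m - n))))) => t.
by rewrite coswB// coswD; field.
Qed.

Lemma trig1_sin_cos m n : trig1 (fun t => sinw m t * cosw n t).
Proof.
have [nm|/ltnW mn] := leqP n m.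
  apply: (trig1_ext _ (trig1_Z (1 / 2) (trig1_D (trig1_sin (m - n)) (trig1_sin (m + n))))) => t.
  by rewrite sinwB// sinwD; field.
apply: (trig1_ext _ (trig1_Z (1 / 2)
  (trig1_lin (-1) (trig1_sin (n - m)) (trig1_sin (m + n))))) => t.
by rewrite sinwB// sinwD; field.
Qed.

Lemma trig1_M p q : trig1 p -> trig1 q -> trig1 (fun t => p t * q t).
Proof.
move=> tp; elim: tp q => {p} [m|m|a p1 p2 _ IH1 _ IH2] q tq.
- elim: tq => {q} [n|n|b q1 q2 _ IH1 _ IH2]; first exact: trig1_cos_cos.
    by apply: (trig1_ext _ (trig1_sin_cos n m)) => t; rewrite mulrC.
  by apply: (trig1_ext _ (trig1_lin b IH1 IH2)) => t; ring.
- elim: tq => {q} [n|n|b q1 q2 _ IH1 _ IH2]; first exact: trig1_sin_cos.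
    exact: trig1_sin_sin.
  by apply: (trig1_ext _ (trig1_lin b IH1 IH2)) => t; ring.
- by apply: (trig1_ext _ (trig1_lin a (IH1 _ tq) (IH2 _ tq))) => t; ring.
Qed.

Lemma trig1_X p n : trig1 p -> trig1 (fun t => p t ^+ n).
Proof.
move=> tp; elim: n => [|n IH]; first exact: trig1_cst.
by apply: (trig1_ext _ (trig1_M tp IH)) => t; rewrite exprS.
Qed.

Lemma trig1_fourier p : trig1 p ->
  exists N (c : nat -> R), forall t, p t = \sum_(k < N) c k * fourier1 k.+1 t.
Proof.
have f1 N k (a : R) : (k < N)%N -> forall t,
    \sum_(i < N) (if i == k :> nat then a else 0) * fourier1 i.+1 t = a * fourier1 k.+1 t.
  move=> kN t; rewrite (bigD1 (Ordinal kN))//= eqxx big1 ?addr0// => i ik.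
  by rewrite (_ : i == k :> nat = false) ?mul0r//; apply/negbTE; exact: ik.
have s0 : Num.sqrt 2 != 0 :> R by rewrite gt_eqF// sqrtr_gt0.
elim=> {p} [n|n|a p1 p2 _ [N1 [c1 H1]] _ [N2 [c2 H2]]].
- have [->|n0] := posnP n.
    exists 1%N, (fun i => if i == 0%N then 1 else 0) => t.
    by rewrite (f1 1%N 0%N)// cosw0 /fourier1 eqxx mulr1.
  exists n.*2, (fun i => if i == n.*2.-1 then (Num.sqrt 2)^-1 else 0) => t.
  rewrite f1; last by lia.
  rewrite fourier1E (_ : n.*2.-1.+1 == 1 = false)%N; last by lia.
  rewrite (_ : odd n.*2.-1.+1 = false); last by lia.
  by rewrite (_ : n.*2.-1.+1./2 = n); [rewrite mulKf|lia].
- have [->|n0] := posnP n.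
    by exists 0%N, (fun i => 0) => t; rewrite big_ord0 sinw0.
  exists n.*2.+1, (fun i => if i == n.*2 then (Num.sqrt 2)^-1 else 0) => t.
  rewrite f1; last by lia.
  rewrite fourier1E (_ : n.*2.+1 == 1 = false)%N; last by lia.
  rewrite (_ : odd n.*2.+1 = true); last by lia.
  by rewrite (_ : n.*2.+1./2 = n); [rewrite mulKf|lia].
- exists (maxn N1 N2), (fun k => a * (if (k < N1)%N then c1 k else 0) +
    (if (k < N2)%N then c2 k else 0)) => t.
  rewrite H1 H2 (big_ord_widen _ (fun k => c1 k * fourier1 k.+1 t) (leq_maxl N1 N2)).
  rewrite (big_ord_widen _ (fun k => c2 k * fourier1 k.+1 t) (leq_maxr N1 N2)).
  rewrite [X in _ * X + _]big_mkcond [X in _ + X]big_mkcond/= mulr_sumr -big_split/=; apply: eq_bigr => k _.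
  by case: ifP => _; case: ifP => _; ring.
Qed.

(** The uniform bounds make products of such approximations work for
    intersections, and later allow dominated convergence. *)
Definition trig_set A := exists u : nat -> R -> R,
  [/\ forall n, trig1 (u n), forall n t, 0 <= u n t <= 1 &
      forall t, t \in `]0, 1[ -> u ^~ t @ \oo --> (\1_A t : R)].

Lemma trig_set_eq A B : (forall t, t \in `]0, 1[ -> A t <-> B t) -> trig_set A -> trig_set B.
Proof.
move=> AB [u [tu u01 uA]]; exists u; split => // t t01.
rewrite (_ : \1_B t = \1_A t :> R); first exact: uA.
by rewrite !indicE; congr (nat_of_bool _)%:R; apply/asboolP/asboolP => /AB; exact.
Qed.

Lemma trig_setC A : trig_set A -> trig_set (~` A).
Proof.
move=> [u [tu u01 uA]]; exists (fun n t => 1 - u n t); split.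
- by move=> n; apply: (trig1_ext _ (trig1_lin (-1) (tu n) (trig1_cst 1))) => t; ring.
- by move=> n t; have := u01 n t; lra.
- move=> t t01; rewrite (_ : \1_(~` A) t = 1 - \1_A t :> R); last first.
    by rewrite indicC indicE; case: (t \in A); rewrite /= ?subrr ?subr0.
  by apply: cvgB; [exact: cvg_cst|exact: uA].
Qed.

Lemma trig_setI A B : trig_set A -> trig_set B -> trig_set (A `&` B).
Proof.
move=> [u [tu u01 uA]] [v [tv v01 vB]]; exists (fun n t => u n t * v n t); split.
- by move=> n; exact: trig1_M.
- move=> n t; have /andP[u0 u1] := u01 n t; have /andP[v0 v1] := v01 n t.
  by rewrite mulr_ge0//= mulr_ile1.
- by move=> t t01; rewrite indicI; apply: cvgM; [exact: uA|exact: vB].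
Qed.

Lemma trig_setT : trig_set setT.
Proof.
exists (fun _ _ => 1); split; first by move=> _; exact: trig1_cst.
- by move=> _ t; rewrite ler01 lexx.
- by move=> t _; rewrite indicT; exact: cvg_cst.
Qed.

Lemma bernoulli (x : R) n : -1 <= x -> 1 + n%:R * x <= (1 + x) ^+ n.
Proof.
move=> x1; elim: n => [|n IH]; first by rewrite mul0r addr0 expr0.
rewrite exprS; apply: (@le_trans _ _ ((1 + x) * (1 + n%:R * x))); last first.
  by apply: ler_wpM2l => //; lra.
have := mulr_ge0 (ler0n R n) (sqr_ge0 x); rewrite -[n.+1%:R]natr1; nra.
Qed.

Lemma cvg_natM_expr (y : R) : 0 <= y < 1 -> (fun n => n%:R * y ^+ n) @ \oo --> (0 : R).
Proof.
move=> /andP[y0 y1]; have [->|yn0] := eqVneq y 0.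
  rewrite (_ : (fun n => _) = fun=> 0); first exact: cvg_cst.
  by apply/funext => -[|n]; rewrite ?mul0r// expr0n mulr0.
pose s := Num.sqrt y; have s0 : 0 < s by rewrite sqrtr_gt0 lt_def yn0.
have s1 : s < 1 by rewrite -sqrtr1 ltr_sqrt.
have h0 : 0 < s^-1 - 1 by rewrite subr_gt0 invf_gt1.
(* y ^+ n is the square of s ^+ n, and n * s ^+ n stays bounded *)
apply: (@squeeze_cvgr _ _ _ _ (fun=> 0) (fun n => (s^-1 - 1)^-1 * s ^+ n)).
- apply: nearW => n; rewrite mulr_ge0 ?exprn_ge0//=.
  rewrite -(sqr_sqrtr y0) -/s -exprM mulnC exprM expr2 mulrA.
  apply: ler_wpM2r; first by rewrite exprn_ge0// ltW.
  have sn : 0 < s ^+ n by rewrite exprn_gt0.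
  rewrite -ler_pdivlMr// -(ler_pM2l h0) mulVKf ?gt_eqF//.
  rewrite -exprVn mulrC; have := @bernoulli (s^-1 - 1) n.
  rewrite [1 + (_ - 1)]addrC subrK => b; have {b} := b _; lra.
- exact: cvg_cst.
- rewrite -[X in _ --> X](mulr0 (s^-1 - 1)^-1); apply: cvgM; first exact: cvg_cst.
  by apply: cvg_expr; rewrite ger0_norm// ltW.
Qed.

(** Bernoulli's inequality squeezes [(1 - x ^+ n) ^+ (n * 2 ^ n)] between
    [1 - n * (2 * x) ^+ n] and [(1 + n * (2 * x) ^+ n)^-1]; the
    factor [n] in the exponent decides the limit at the threshold itself. *)
Lemma cvg_threshold (x : R) : 0 <= x <= 1 ->
  (fun n => (1 - x ^+ n) ^+ (n * 2 ^ n)) @ \oo --> ((x < 1 / 2)%R%:R : R).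
Proof.
move=> /andP[x0 x1].
have xn n : 0 <= x ^+ n <= 1 by rewrite exprn_ge0//= exprn_ile1.
have N n : ((n * 2 ^ n)%:R * x ^+ n) = n%:R * (2 * x) ^+ n.
  by rewrite natrM natrX exprMn mulrA.
case: ltrP => x2.
  apply: (@squeeze_cvgr _ _ _ _ (fun n => 1 - n%:R * (2 * x) ^+ n) (fun=> 1)).
  - apply: nearW => n; have /andP[h0 h1] := xn n.
    have := @bernoulli (- x ^+ n) (n * 2 ^ n); rewrite mulrN N => -> /=; last by lra.
    by apply: exprn_ile1; lra.
  - rewrite -[X in _ --> X]subr0; apply: cvgB; first exact: cvg_cst.
    by apply: cvg_natM_expr; lra.
  - exact: cvg_cst.
apply: (@squeeze_cvgr _ _ _ _ (fun=> 0) harmonic); last exact: cvg_harmonic.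
- apply: nearW => n; have /andP[h0 h1] := xn n.
  have n0 : 0 < n.+1%:R :> R by rewrite ltr0n.
  rewrite exprn_ge0/=; last by lra.
  rewrite /harmonic -[leRHS]mul1r ler_pdivlMr//.
  have b1 : n.+1%:R <= (1 + x ^+ n) ^+ (n * 2 ^ n).
    apply: le_trans (@bernoulli _ _ _); last by lra.
    rewrite N -[n.+1%:R]natr1; have : 1 <= (2 * x) ^+ n by rewrite exprn_ege1//; lra.
    by move/(ler_wpM2l (ler0n R n)); rewrite mulr1; lra.
  apply: (@le_trans _ _ ((1 - x ^+ n) ^+ (n * 2 ^ n) * (1 + x ^+ n) ^+ (n * 2 ^ n))).
    by apply: ler_wpM2l => //; rewrite exprn_ge0//; lra.
  by rewrite -exprMn exprn_ile1//; have := sqr_ge0 (x ^+ n); nra.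
- exact: cvg_cst.
Qed.

Lemma trig_set_threshold p : trig1 p -> (forall t, 0 <= p t <= 1) ->
  trig_set [set t | p t < 1 / 2].
Proof.
move=> tp p01; exists (fun n t => (1 - p t ^+ n) ^+ (n * 2 ^ n)); split.
- move=> n; apply: trig1_X.
  by apply: (trig1_ext _ (trig1_lin (-1) (trig1_X n tp) (trig1_cst 1))) => t; ring.
- move=> n t; have /andP[p0 p1] := p01 t.
  have h0 := exprn_ge0 n p0; have h1 := exprn_ile1 n p0 p1.
  by rewrite exprn_ge0 ?exprn_ile1//; lra.
- move=> t _; have := cvg_threshold (p01 t); congr (_ --> _).
  by rewrite indicE; congr (nat_of_bool _)%:R; apply/idP/idP; rewrite inE.
Qed.

Lemma cosw_inj_lt (s t : R) : 0 <= s <= 1 / 2 -> 0 <= t <= 1 / 2 ->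
  (cosw 1 s < cosw 1 t) = (t < s).
Proof.
have p0 := @pi_gt0 R.
move=> s2 t2; rewrite /cosw !mulr1 ltr_cos.
- by rewrite ltr_pM2l// mulr_gt0.
- rewrite in_itv/=; nra.
- rewrite in_itv/=; nra.
Qed.

Lemma cosw_sym (t : R) : cosw 1 (1 - t) = cosw 1 t.
Proof.
by rewrite /cosw mulr1 mulrBr mulr1 addrC [2 * pi]mulr_natl cosD2pi cosN.
Qed.

Lemma sinw_gt0 (t : R) : 0 < t < 1 / 2 -> 0 < sinw 1 t.
Proof. have p0 := @pi_gt0 R; move=> t2; apply: sin_gt0_pi; rewrite mulr1; nra. Qed.

Lemma sinw_sym (t : R) : sinw 1 (1 - t) = - sinw 1 t.
Proof.
by rewrite /sinw mulr1 mulrBr mulr1 addrC [2 * pi]mulr_natl sinD2pi sinN.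
Qed.

Lemma sinw_half : sinw 1 (1 / 2) = 0 :> R.
Proof. by rewrite /sinw (_ : _ * _ = pi) ?sinpi//; field. Qed.

Lemma trig_set_cos (c : R) : trig_set [set t | cosw 1 c < cosw 1 t].
Proof.
pose p (t : R) := (- 1 / 4) * cosw 1 t + (1 / 2 + cosw 1 c / 4).
apply: (@trig_set_eq [set t | p t < 1 / 2]).
  by move=> t _; rewrite /p /=; split; lra.
apply: trig_set_threshold; first exact: trig1_lin (trig1_cos 1) (trig1_cst _).
move=> t; rewrite /p /cosw.
have := cos_geN1 (2 * pi * 1 * t); have := cos_le1 (2 * pi * 1 * t).
by have := cos_geN1 (2 * pi * 1 * c); have := cos_le1 (2 * pi * 1 * c); lra.
Qed.

Lemma trig_set_cos_lt (c : R) : trig_set [set t | cosw 1 t < cosw 1 c].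
Proof.
pose p (t : R) := (1 / 4) * cosw 1 t + (1 / 2 - cosw 1 c / 4).
apply: (@trig_set_eq [set t | p t < 1 / 2]).
  by move=> t _; rewrite /p /=; split; lra.
apply: trig_set_threshold; first exact: trig1_lin (trig1_cos 1) (trig1_cst _).
move=> t; rewrite /p /cosw.
have := cos_geN1 (2 * pi * 1 * t); have := cos_le1 (2 * pi * 1 * t).
by have := cos_geN1 (2 * pi * 1 * c); have := cos_le1 (2 * pi * 1 * c); lra.
Qed.

Lemma trig_set_half : trig_set [set t : R | 0 < sinw 1 t].
Proof.
pose p (t : R) := (- 1 / 4) * sinw 1 t + 1 / 2.
apply: (@trig_set_eq [set t | p t < 1 / 2]).
  by move=> t _; rewrite /p /=; split; lra.
apply: trig_set_threshold; first exact: trig1_lin (trig1_sin 1) (trig1_cst _).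
move=> t; rewrite /p /sinw.
by have := sin_geN1 (2 * pi * 1 * t); have := sin_le1 (2 * pi * 1 * t); lra.
Qed.

(** On the first half of the period the cosine decreases and the sine is
    positive; this isolates the initial segments.  Symmetry handles the others. *)
Lemma trig_set_lt (c : R) : trig_set [set t | t < c].
Proof.
have Z : trig_set (set0 : set R) by rewrite -setCT; exact/trig_setC/trig_setT.
have sgt (t : R) : t \in `]0, 1[ -> (0 < sinw 1 t) = (t < 1 / 2).
  rewrite in_itv/= => /andP[t0 t1]; case: (ltP t (1 / 2)) => t2; first by rewrite sinw_gt0 ?t0.
  apply/negbTE; rewrite -leNgt; move: t2; rewrite le_eqVlt => /predU1P[<-|t2].
    by rewrite sinw_half.
  by rewrite -oppr_ge0 -sinw_sym ltW// sinw_gt0//; lra.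
have [c0|c0] := leP c 0.
  by apply: (trig_set_eq _ Z) => t; rewrite in_itv/=; split => //; lra.
have [c1|c1] := leP 1 c.
  by apply: (trig_set_eq _ trig_setT) => t; rewrite in_itv/=; split => //; lra.
have [c2|c2] := leP c (1 / 2).
  apply: (trig_set_eq _ (trig_setI (trig_set_cos c) trig_set_half)) => t t01.
  rewrite /= sgt//; move: t01; rewrite in_itv/= => /andP[t0 t1]; split.
    by move=> [h t2]; move: h; rewrite cosw_inj_lt//; lra.
  by move=> tc; rewrite cosw_inj_lt; lra.
have E : trig_set (~` (~` [set t | 0 < sinw 1 t] `&` ~` [set t | cosw 1 t < cosw 1 c])).
  by apply/trig_setC/trig_setI; apply: trig_setC; [exact: trig_set_half|exact: trig_set_cos_lt].
apply: (trig_set_eq _ E) => t t01; rewrite setCI !setCK /= sgt//.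
move: t01; rewrite in_itv/= => /andP[t0 t1].
rewrite -(cosw_sym c) -(cosw_sym t); have [t2|t2] := ltP t (1 / 2); first by split; lra.
by rewrite cosw_inj_lt; [split; [case => //|right]|..]; lra.
Qed.
End one_dimension.

Section density.
Context {R : realType} (d : nat).
Notation mu := (@lebesgue_tuple R d).
Notation C := (cube d : set (d.-tuple R)).
Notation fn := (d.-tuple R -> R).
Implicit Types (f g h : fn).

Definition open_cube : set (d.-tuple R) := [set x | forall m, `]0, 1[%classic (tnth x m)].

(** Trigonometric polynomials take the same value at both ends of the unit
    interval, so that convergence can only be asked inside the cube. *)
Lemma ae_open_cube (P : d.-tuple R -> Prop) : (forall x, open_cube x -> P x) ->
  {ae mu, forall x, C x -> P x}.
Proof.
move=> OP.
have mO : measurable open_cube by apply: (@measurable_box R d (fun=> `]0, 1[%classic)).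
have OC : open_cube `<=` C.
  move=> x Ox m; have := Ox m; rewrite /= !in_itv/= => /andP[h0 h1].
  by rewrite !ltW.
exists (C `\` open_cube); split.
- exact: measurableD.
- have mCE : mu C = 1%E by exact: cube_measure1.
  have mOE : mu open_cube = 1%E.
    rewrite (@lebesgue_tuple_box _ d (fun=> `]0, 1[%classic))// big1// => m _.
    by rewrite [LHS](lebesgue_measure_itv `]0, 1[) /= lte_fin ltr01 oppr0 adde0.
  rewrite measureD//; last by rewrite [ltLHS]mCE ltry.
  by rewrite ((setIidPr _ _).2 OC) [X in (X - _)%E]mCE [X in (_ - X)%E]mOE subee.
- move=> x /= nP; have Cx : C x by apply: contrapT => nC; apply: nP.
  by split => // Ox; apply: nP => _; exact: OP.
Qed.

(** Dominated convergence in L2. *)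
Lemma ip_limit (u : nat -> fn) f h : square_integrable f -> square_integrable h ->
  (forall n, square_integrable (u n)) ->
  (forall x, open_cube x -> u ^~ x @ \oo --> f x) ->
  (forall n x, C x -> `|f x - u n x| <= h x) ->
  forall e, 0 < e -> exists n, ip (fun x => f x - u n x) (fun x => f x - u n x) <= e.
Proof.
move=> sf sh su uf fuh e e0.
pose v n x := ((f x - u n x) * (f x - u n x))%:E.
have iv n : mu.-integrable C (v n) by apply: sqint_mul; exact: sqintB.
have mv n : measurable_fun C (v n) by exact: measurable_int (iv n).
have m0 : measurable_fun C (cst 0%E : d.-tuple R -> \bar R) by exact: measurable_cst.
have v0 : {ae mu, forall x, C x -> v ^~ x @ \oo --> (cst 0%E : d.-tuple R -> \bar R) x}.
  apply: ae_open_cube => x Ox; apply/cvg_EFin; first exact: nearW.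
  rewrite (_ : _ \o _ = fun n => (f x - u n x) * (f x - u n x))//.
  rewrite -[0](mulr0 0) -[in X in X * 0](subrr (f x)) -[in X in _ * X](subrr (f x)).
  by apply: cvgM; apply: cvgB; (try exact: cvg_cst); exact: uf.
have vh : {ae mu, forall x n, C x -> (`|v n x| <= ((h x * h x)%:E))%E}.
  apply: aeW => x n Cx; rewrite /v lee_fin normrM.
  by apply: ler_pM => //; exact: fuh.
have [_ _] := dominated_convergence (@measurable_cube R d) mv m0 v0 (sqint_mul sh sh) vh.
rewrite integral0 => /fine_cvgP[_ /cvgrPdist_le/(_ _ e0)[N _ /(_ N (leqnn N))]].
rewrite /= sub0r normrN => H; exists N; apply: le_trans H.
exact: ler_norm.
Qed.

(** ** Closure of the trigonometric polynomials *)

Definition approximable f := forall e, 0 < e -> exists l, all positive_freq (map snd l) /\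
  ip (fun x => f x - trig_sum l x) (fun x => f x - trig_sum l x) <= e.

(** Replaces the triangle inequality, avoiding square roots. *)
Lemma ip_sqrD_le f g : square_integrable f -> square_integrable g ->
  ip (fun x => f x + g x) (fun x => f x + g x) <= 2 * ip f f + 2 * ip g g.
Proof.
move=> sf sg; have := ip_ge0 (fun x => f x + (-1) * g x).
have sg' := sqintZ (-1) sg.
by rewrite !ip_sqrD// ipZl// (ipC g) ipZl// (ipC f) ipZl// (ipC g f); lra.
Qed.

Lemma approximable_lim f : square_integrable f ->
  (forall e, 0 < e -> exists2 g, square_integrable g /\ approximable g &
     ip (fun x => f x - g x) (fun x => f x - g x) <= e) -> approximable f.
Proof.
move=> sf H e e0; have [g [sg ag] fg] := H (e / 4) ltac:(lra).
have [l [pl gl]] := ag (e / 4) ltac:(lra); exists l; split => //.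
have st := sqint_trig_sum l.
have -> : (fun x => f x - trig_sum l x) = (fun x => (f x - g x) + (g x - trig_sum l x)).
  by apply/funext => x; ring.
apply: le_trans (ip_sqrD_le (sqintB sf sg) (sqintB sg st)) _; lra.
Qed.

Lemma approximable_seq (u : nat -> fn) f h : square_integrable f -> square_integrable h ->
  (forall n, square_integrable (u n)) -> (forall n, approximable (u n)) ->
  (forall x, open_cube x -> u ^~ x @ \oo --> f x) ->
  (forall n x, C x -> `|f x - u n x| <= h x) -> approximable f.
Proof.
move=> sf sh su au uf fuh; apply: approximable_lim => // e e0.
by have [n ?] := ip_limit sf sh su uf fuh e0; exists (u n).
Qed.

Lemma approximable_trig_sum l : all positive_freq (map snd l) -> approximable (trig_sum l).
Proof.
move=> pl e e0; exists l; split => //; apply: le_trans (ltW e0).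
have -> : (fun x => trig_sum l x - trig_sum l x) = (fun x => 0 * trig_sum l x).
  by apply/funext => x; rewrite subrr mul0r.
by have st := sqint_trig_sum l; rewrite ipZl ?mul0r//; exact: sqintZ.
Qed.

Lemma approximableD f g : square_integrable f -> square_integrable g ->
  approximable f -> approximable g -> approximable (fun x => f x + g x).
Proof.
move=> sf sg af ag e e0.
have [l [pl fl]] := af (e / 4) ltac:(lra); have [k [pk gk]] := ag (e / 4) ltac:(lra).
exists (l ++ k); split; first by rewrite map_cat all_cat pl.
have -> : (fun x => f x + g x - trig_sum (l ++ k) x) =
    (fun x => (f x - trig_sum l x) + (g x - trig_sum k x)).
  by apply/funext => x; rewrite /trig_sum big_cat/=; ring.
have sl := sqint_trig_sum l; have sk := sqint_trig_sum k.
apply: le_trans (ip_sqrD_le (sqintB sf sl) (sqintB sg sk)) _; lra.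
Qed.

Lemma approximableZ a f : square_integrable f -> approximable f ->
  approximable (fun x => a * f x).
Proof.
move=> sf af e e0.
have a1 : 0 < a ^+ 2 + 1 by have := sqr_ge0 a; lra.
have [l [pl fl]] := af (e / (a ^+ 2 + 1)) (divr_gt0 e0 a1).
exists [seq (a * u.1, u.2) | u <- l]; split; first by rewrite -map_comp.
have -> : (fun x => a * f x - trig_sum [seq (a * u.1, u.2) | u <- l] x) =
    (fun x => a * (f x - trig_sum l x)).
  apply/funext => x; rewrite /trig_sum big_map/= mulrBr mulr_sumr; congr (_ - _).
  by apply: eq_bigr => u _; rewrite mulrA.
have sl := sqintB sf (sqint_trig_sum l); have sal := sqintZ a sl.
rewrite ipZl// ipC ipZl// mulrA -expr2.
have := ip_ge0 (fun x => f x - trig_sum l x).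
by move: fl; rewrite ler_pdivlMr//; nra.
Qed.

Lemma approximable_sum I (s : seq I) (F : I -> fn) : (forall i, square_integrable (F i)) ->
  (forall i, approximable (F i)) -> approximable (fun x => \sum_(i <- s) F i x).
Proof.
move=> sF aF; elim: s => [|i s IH].
  rewrite (_ : (fun x => _) = trig_sum [::]); first exact: approximable_trig_sum.
  by apply/funext => x; rewrite /trig_sum !big_nil.
under eq_fun do rewrite big_cons; apply: approximableD => //; exact: sqint_sum.
Qed.

(** ** Indicators of boxes *)

(** Expanding a product of one-dimensional polynomials by distributivity; a common
    degree [N] makes the index set a type of finite functions. *)
Lemma trig_sum_prod (p : 'I_d -> R -> R) : (forall m, trig1 (p m)) ->
  exists l, all positive_freq (map snd l) /\
    (fun x : d.-tuple R => \prod_(m < d) p m (tnth x m)) = trig_sum l.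
Proof.
move=> tp.
have /choice[N0 H0] : forall m, exists N, exists c : nat -> R,
    forall t, p m t = \sum_(k < N) c k * fourier1 k.+1 t by move=> m; exact: trig1_fourier.
pose N := (\max_(m < d) N0 m)%N.
have /choice[c Hc] : forall m, exists c : nat -> R,
    forall t, p m t = \sum_(k < N) c k * fourier1 k.+1 t.
  move=> m; have [c Hc] := H0 m; exists (fun k => if (k < N0 m)%N then c k else 0) => t.
  rewrite Hc (big_ord_widen N (fun k => c k * fourier1 k.+1 t)); last exact: leq_bigmax.
  by rewrite big_mkcond; apply: eq_bigr => k _; case: ifP => _; rewrite ?mul0r.
exists [seq (\prod_(m < d) c m (k m), [ffun m => (k m).+1]) | k : {ffun 'I_d -> 'I_N}].
split.
  apply/allP => j /mapP[u /mapP[k _ ->] ->] /=.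
  by apply/forallP => m; rewrite ffunE.
apply/funext => x; under eq_bigr do rewrite Hc.
rewrite bigA_distr_bigA /trig_sum big_map big_enum/=; apply: eq_bigr => k _.
rewrite big_split/=; congr (_ * _); apply: eq_bigr => m _; by rewrite ffunE.
Qed.

Definition box (A : 'I_d -> set R) : set (d.-tuple R) := [set x | forall m, A m (tnth x m)].

Lemma indic_box (A : 'I_d -> set R) x :
  \1_(box A) x = \prod_(m < d) \1_(A m) (tnth x m) :> R.
Proof.
rewrite indicE; case: (boolP (x \in box A)) => [/set_mem xA|xA].
  by rewrite big1// => m _; rewrite indicE mem_set.
have [m xm] : exists m, ~ A m (tnth x m).
  by apply/existsNP => H; move/negP: xA; apply; rewrite inE.
by rewrite (bigD1 m)//= indicE memNset// mul0r.
Qed.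

Lemma bounded_on_cube_indic (A : set (d.-tuple R)) : measurable A ->
  bounded_on_cube (\1_A : fn).
Proof.
move=> mA; split; first exact: measurable_indic.
by exists 1 => x _; rewrite indicE; case: (x \in A); rewrite ?normr1 ?normr0.
Qed.

Lemma sqint_indic (A : set (d.-tuple R)) : measurable A -> square_integrable (\1_A : fn).
Proof. by move=> mA; apply: sqint_bounded; exact: bounded_on_cube_indic. Qed.

Lemma approximable_box (A : 'I_d -> set R) : (forall m, measurable (A m)) ->
  (forall m, trig_set (A m)) -> approximable (\1_(box A)).
Proof.
move=> mA /choice[u Hu].
have mB : measurable (box A) by exact: measurable_box.
have u01 n m t : 0 <= u m n t <= 1 by have [_ + _] := Hu m; exact.
have p01 n x : 0 <= \prod_(m < d) u m n (tnth x m) <= 1.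
  rewrite prodr_ge0 => [|m _]; last by case/andP: (u01 n m (tnth x m)).
  by apply: prodr_ile1 => m _; exact: u01.
have tu n : exists l, all positive_freq (map snd l) /\
    (fun x : d.-tuple R => \prod_(m < d) u m n (tnth x m)) = trig_sum l.
  by apply: (@trig_sum_prod (fun m => u m n)) => m; have [+ _ _] := Hu m; exact.
apply: (@approximable_seq (fun n x => \prod_(m < d) u m n (tnth x m)) _ (fun=> 1)).
- exact: sqint_indic.
- by apply: sqint_bounded; exact: bounded_on_cube_cst.
- by move=> n; have [l [_ ->]] := tu n; exact: sqint_trig_sum.
- by move=> n; have [l [pl ->]] := tu n; exact: approximable_trig_sum.
- move=> x Ox; rewrite indic_box.
  apply: (cvg_big (@mul_continuous _)) => m _.
  by have [_ _ + ] := Hu m; apply; exact: Ox.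
- move=> n x _; have /andP[h0 h1] := p01 n x.
  by rewrite indicE; case: (x \in box A); rewrite /= ler_norml ?mulr1n ?mulr0n; lra.
Qed.

(** ** Measurable sets *)

(** A system of boxes closed under intersection that generates the measurable
    sets; whole lines are allowed as factors so that each coordinate can be
    constrained alone. *)
Definition half_line_box : set (set (d.-tuple R)) :=
  [set B | exists2 A : 'I_d -> set R,
     (forall m, A m = setT \/ exists c, A m = [set t | t < c]) & B = box A].

Lemma measurable_half_line (A : set R) :
  A = setT \/ (exists c, A = [set t | t < c]) -> measurable A.
Proof.
by move=> [->//|[c ->]]; exact: (@measurable_itv R `]-oo, c[).
Qed.

Lemma half_line_box_setI : setI_closed half_line_box.
Proof.
move=> _ _ [A HA ->] [B HB ->]; exists (fun m => A m `&` B m).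
  move=> m; case: (HA m) => [->|[a ->]]; first by rewrite setTI; exact: HB.
  right; case: (HB m) => [->|[b ->]]; first by exists a; rewrite setIT.
  exists (Num.min a b); apply/seteqP; split => t /=; rewrite lt_min; first by move=> [-> ->].
  by move=> /andP[].
by apply/seteqP; split => x /=; [move=> [xA xB] m; split|move=> xAB; split=> m; have [] := xAB m].
Qed.

Lemma measurable_half_line_box (B : set (d.-tuple R)) : half_line_box B -> measurable B.
Proof. by move=> [A HA ->]; apply: measurable_box => m; exact: measurable_half_line. Qed.

Lemma sigma_half_line_box : (measurable : set (set (d.-tuple R))) `<=` <<s half_line_box>>.
Proof.
apply: smallest_sub; first exact: smallest_sigma_algebra.
move=> B; rewrite -bigcup_seq => -[i _ [S mS <-]]; rewrite setTI.
(* the sets of reals whose preimage is generated form a sigma-algebra *)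
pose H := [set S : set R | <<s half_line_box>> ((@tnth d R ^~ i) @^-1` S)].
have [s0 sC sU] := smallest_sigma_algebra setT half_line_box.
suff : (measurable : set (set R)) `<=` H by apply.
have -> : (measurable : set (set R)) = <<s @RGenInftyO.G R>>.
  exact: RGenInftyO.measurableE.
apply: smallest_sub.
  split.
  - by rewrite /H/= preimage_set0.
  - by move=> A HA; rewrite /H/= setTD preimage_setC -setTD; exact: sC.
  - by move=> A HA; rewrite /H/= preimage_bigcup; exact: sU.
move=> _ [c ->]; apply: sub_sigma_algebra.
exists (fun m => if m == i then [set t | t < c] else setT).
  by move=> m; case: (m == i); [right; exists c|left].
apply/seteqP; split => x /=.
  by rewrite in_itv/= => xc m; case: eqP => [->|].
by move=> /(_ i); rewrite eqxx in_itv.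
Qed.

(** Dynkin's pi-lambda theorem: the sets with approximable indicator are stable
    under proper differences and increasing unions. *)
Lemma approximable_indic (A : set (d.-tuple R)) : measurable A -> approximable (\1_A).
Proof.
pose H := [set A : set (d.-tuple R) | measurable A /\ approximable (\1_A)].
suff HH : <<s half_line_box>> `<=` H by move=> /sigma_half_line_box/HH[].
apply: lambda_system_subset; [exact: half_line_box_setI| | |by []].
  split => //.
  - have -> : [set: d.-tuple R] = box (fun=> setT) by apply/seteqP; split.
    split; first exact: measurable_box.
    by apply: approximable_box => // m; exact: trig_setT.
  - move=> U V VU [mU aU] [mV aV]; split; first exact: measurableD.
    have -> : \1_(U `\` V) = (fun x => \1_U x + (-1) * \1_V x) :> fn.
      apply/funext => x; rewrite !indicE in_setD; case: (boolP (x \in V)) => [/set_mem xV|_].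
        by rewrite mem_set ?andbF /= ?mulN1r ?subrr//; exact: VU.
      by rewrite andbT mulr0 addr0.
    apply: approximableD; [exact: sqint_indic|by apply/sqintZ/sqint_indic|by []|].
    by apply: approximableZ => //; exact: sqint_indic.
  - move=> F ndF HF; have mF n : measurable (F n) by have [] := HF n.
    have mU : measurable (\bigcup_n F n) by exact: bigcup_measurable.
    split => //; apply: (@approximable_seq (fun n => \1_(F n)) _ (fun=> 1)).
    + exact: sqint_indic.
    + by apply: sqint_bounded; exact: bounded_on_cube_cst.
    + by move=> n; exact: sqint_indic.
    + by move=> n; have [] := HF n.
    + move=> x _; rewrite indicE; case: (boolP (_ \in _)) => [/set_mem[N _ FN]|nU].
        apply: (cvg_near_cst (1 : R)).
        exists N => // n /= Nn; rewrite indicE mem_set//.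
        by move: FN; apply/subsetPset/ndF.
      rewrite (_ : (fun n => _) = fun=> 0); first exact: cvg_cst.
      apply/funext => n; rewrite indicE memNset// => Fn.
      by move/negP: nU; apply; rewrite inE; exists n.
    + move=> n x _; rewrite !indicE.
      by case: (x \in _); case: (x \in _); rewrite /= ?subrr ?subr0 ?sub0r ?normrN ?normr1 ?normr0.
move=> B HB; split; first exact: measurable_half_line_box.
case: HB => A0 HA ->; apply: approximable_box => m; first exact: measurable_half_line.
by case: (HA m) => [->|[c ->]]; [exact: trig_setT|exact: trig_set_lt].
Qed.

Import HBNNSimple.

Lemma approximable_ge0 f : square_integrable f -> (forall x, C x -> 0 <= f x) -> approximable f.
Proof.
move=> sf f0.
have mf : measurable_fun C (EFin \o f) by apply/measurable_EFinP; exact: sf.1.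
pose g := nnsfun_approx (@measurable_cube R d) mf.
have gf n x : C x -> g n x <= f x.
  move=> Cx; rewrite -lee_fin nnsfun_approxE.
  exact: (le_approx n (fun y Cy => (f0 y Cy : (0%:E <= (EFin \o f) y)%E)) Cx).
have gE n : (g n : fn) = fun x =>
    \sum_(y <- finmap.enum_fset (fset_set (range (g n)))) y * \1_(g n @^-1` [set y]) x.
  apply/funext => x; rewrite [LHS]fimfunE fsbig_finite//=.
have mg n y : measurable (g n @^-1` [set y] : set (d.-tuple R)).
  by rewrite -[X in measurable X]setTI; exact: measurable_funP.
apply: (@approximable_seq (fun n => g n) _ f) => //.
- by move=> n; rewrite gE; apply: sqint_sum => y; apply/sqintZ/sqint_indic.
- move=> n; rewrite gE; apply: approximable_sum => y; first exact/sqintZ/sqint_indic.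
  by apply: approximableZ; [exact: sqint_indic|exact: approximable_indic].
- move=> x Ox; have Cx : C x.
    by move=> m; have := Ox m; rewrite /= !in_itv/= => /andP[h0 h1]; rewrite !ltW.
  have /fine_cvgP[_] := cvg_nnsfun_approx (@measurable_cube R d) mf
    (fun y Cy => (f0 y Cy : (0%:E <= (EFin \o f) y)%E)) Cx.
  exact.
- move=> n x Cx; rewrite ger0_norm ?subr_ge0 ?gf// gerBl.
  exact: fun_ge0.
Qed.

Lemma sqint_max0 f : square_integrable f -> square_integrable (fun x => Num.max (f x) 0).
Proof.
move=> sf; have m0 : measurable_fun C (fun x => Num.max (f x) 0).
  by apply: measurable_maxr; [exact: sf.1|exact: measurable_cst].
split => //; apply: le_integrable sf.2 => //.
  by apply/measurable_EFinP; exact: measurable_funX.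
move=> x _; rewrite lee_fin !ger0_norm ?sqr_ge0//.
by rewrite /Order.max; case: ifP => _ //; rewrite expr0n sqr_ge0.
Qed.

(** Simple functions approximate the positive and the negative part from below,
    and their level sets have approximable indicators. *)
Lemma trig_dense f : square_integrable f -> approximable f.
Proof.
move=> sf; have sNf := sqintZ (-1) sf.
have -> : f = (fun x => Num.max (f x) 0 + (-1) * Num.max (-1 * f x) 0).
  by apply/funext => x; rewrite !mulN1r; case: (leP (f x) 0) => h1; case: (leP (- f x) 0) => h2; lra.
apply: approximableD; [exact: sqint_max0|exact/sqintZ/sqint_max0| |].
  by apply: approximable_ge0 => [|x _]; [exact: sqint_max0|rewrite le_max lexx orbT].
apply: approximableZ; first exact: sqint_max0.
by apply: approximable_ge0 => [|x _]; [exact: sqint_max0|rewrite le_max lexx orbT].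
Qed.
End density.

(** * The approximation error and the loss *)

(** The limiting argument that removes the density error; stated for squares since
    [y] comes from the Cauchy-Schwarz inequality. *)
Lemma le_of_small_errors (R : realType) (x b a : R) : 0 <= a ->
  (forall e, 0 < e -> exists y z, [/\ x = y + z, `|z| <= b & y ^+ 2 <= a * e]) -> `|x| <= b.
Proof.
move=> a0 H; rewrite leNgt; apply/negP => bx.
have e0 : 0 < (`|x| - b) ^+ 2 / (2 * (a + 1)).
  by rewrite divr_gt0 ?exprn_gt0 ?subr_gt0//; lra.
have [y [z [xyz zb]]] := H _ e0.
have n1 : `|x| - b <= `|y| by rewrite xyz; have := ler_normD y z; lra.
have n2 : (`|x| - b) ^+ 2 <= y ^+ 2.
  by rewrite -[leRHS]real_normK ?num_real// ler_sqr ?nnegrE ?normr_ge0//; lra.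
have : 0 < (`|x| - b) ^+ 2 by rewrite exprn_gt0// subr_gt0.
move: n2; set q := (_ - b) ^+ 2 => n2 q0.
rewrite mulrA ler_pdivlMr; last by lra.
nra.
Qed.

Section sobolev_loss.
Context {R : realType} (d L : nat).
Hypothesis d_gt0 : (0 < d)%N.
Notation mu := (@lebesgue_tuple R d).
Notation fn := (d.-tuple R -> R).
Implicit Types (f g : fn) (k : {ffun 'I_d -> nat}) (j : mindex d L).

Definition weight (s : R) k : R := \sum_(m < d) (k m)%:R `^ (2 * s).

Lemma weight_ge (s : R) k m : (k m)%:R `^ (2 * s) <= weight s k.
Proof.
rewrite /weight (bigD1 m)//= lerDl; apply: sumr_ge0 => i _; exact: powR_ge0.
Qed.

Lemma weight_gt0 (s : R) k : positive_freq k -> 0 < weight s k.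
Proof.
move=> /forallP/(_ (Ordinal d_gt0)) k0.
by apply: lt_le_trans (weight_ge s k (Ordinal d_gt0)); apply: powR_gt0; rewrite ltr0n.
Qed.

Lemma sobolev_sum_le (s r : R) f (t : seq {ffun 'I_d -> nat}) : sobolev_ball s r f ->
  uniq t -> all positive_freq t ->
  \sum_(k <- t) weight s k * fourier_coef f k ^+ 2 <= r ^+ 2.
Proof.
move=> [_ fs] ut /allP pt; rewrite -lee_fin; apply: le_trans fs.
apply: esum_ge; exists [set` t].
  split; first exact: finite_seq.
  by move=> k /= /pt/forallP.
by rewrite -fsbig_seq// sumEFin.
Qed.

Definition truncation : seq {ffun 'I_d -> nat} := codom (@freq d L).

Lemma freq_inj : injective (@freq d L).
Proof.
move=> i j /ffunP ij; apply/ffunP => m; apply/val_inj; move: (ij m).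
by rewrite !ffunE => -[].
Qed.

Lemma freq_positive j : positive_freq (freq j).
Proof. by apply/forallP => m; rewrite ffunE. Qed.

Lemma uniq_truncation : uniq truncation.
Proof. by rewrite map_inj_uniq ?enum_uniq//; exact: freq_inj. Qed.

Lemma positive_truncation : all positive_freq truncation.
Proof. by apply/allP => k /codomP[j ->]; exact: freq_positive. Qed.

Let J : R := (dyadic_size L)%:R.

Lemma dyadic_size_gt0 : 0 < J.
Proof. by rewrite ltr0n /dyadic_size subn_gt0 -{1}(expn0 2) ltn_exp2l. Qed.

(** A positive frequency outside the box has a coordinate beyond the resolution. *)
Lemma weight_tail (s : R) k : 0 < s -> positive_freq k -> k \notin truncation ->
  J `^ (2 * s) <= weight s k.
Proof.
move=> s0 /forallP pk kT.
have [m km] : exists m, (dyadic_size L <= k m)%N.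
  apply/existsP; rewrite -[X in is_true X]negbK negb_exists; apply: contra kT => /forallP kJ.
  have kJ' m : ((k m).-1 < dyadic_size L)%N by have := kJ m; have := pk m; lia.
  apply/codomP; exists [ffun m => Ordinal (kJ' m)].
  by apply/ffunP => m; rewrite !ffunE/= prednK.
apply: le_trans (weight_ge s k m).
apply: ge0_ler_powR; rewrite ?nnegrE ?ler0n ?ler_nat//.
by rewrite mulr_ge0// ltW.
Qed.

(** The weighted arithmetic-geometric inequality with a scale matching the two
    radii replaces the Cauchy-Schwarz inequality for the tails. *)
Lemma tail_sum_le (beta delta r : R) f g (t : seq {ffun 'I_d -> nat}) :
  0 < beta -> 0 < delta -> 0 < r ->
  sobolev_ball beta r f -> sobolev_ball delta 1 g -> uniq t -> all positive_freq t ->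
  `|\sum_(k <- t | k \notin truncation) fourier_coef f k * fourier_coef g k|
    <= r * J `^ (- (beta + delta)).
Proof.
move=> b0 d0 r0 Wf Wg ut pt; have J0 := dyadic_size_gt0.
apply: le_trans (ler_norm_sum _ _ _) _.
(* the scale at which both weighted tails contribute r J ^ (- (beta + delta)) / 2 *)
pose la := J `^ (beta - delta) / r.
have la0 : 0 < la by rewrite divr_gt0// powR_gt0.
pose T := [seq k <- t | k \notin truncation].
have uT : uniq T by rewrite filter_uniq.
have pT : all positive_freq T by apply/allP => k; rewrite mem_filter => /andP[_]; apply/allP.
have wT k (s : R) : 0 < s -> k \in T -> J `^ (2 * s) <= weight s k.
  move=> s0 kT; apply: weight_tail => //; first exact: (allP pT).
  by move: kT; rewrite mem_filter => /andP[].
have bound (s q : R) h : 0 < s -> sobolev_ball s q h ->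
    \sum_(k <- T) fourier_coef h k ^+ 2 <= q ^+ 2 * J `^ (- (2 * s)).
  move=> s0 Wh; rewrite powRN ler_pdivlMr ?powR_gt0// mulr_suml.
  apply: le_trans (sobolev_sum_le Wh uT pT).
  rewrite big_seq [leRHS]big_seq; apply: ler_sum => k kT.
  by rewrite mulrC ler_wpM2r ?sqr_ge0// wT.
rewrite -big_filter -/T.
apply: (@le_trans _ _ (\sum_(k <- T) (la / 2 * fourier_coef f k ^+ 2 +
    la^-1 / 2 * fourier_coef g k ^+ 2))).
  apply: ler_sum => k _; set a := fourier_coef f k; set b := fourier_coef g k.
  have := sqr_ge0 (la * `|a| - `|b|).
  rewrite sqrrB exprMn !real_normK ?num_real// normrM => h.
  rewrite -(ler_pM2l la0) mulrDr.
  have -> : la * (la^-1 / 2 * b ^+ 2) = b ^+ 2 / 2 by field; rewrite gt_eqF.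
  have := mulr_ge0 (normr_ge0 a) (normr_ge0 b); nra.
rewrite big_split -!mulr_sumr /=.
have f1 := bound _ _ _ b0 Wf; have g1 := bound _ _ _ d0 Wg.
apply: (@le_trans _ _ (la / 2 * (r ^+ 2 * J `^ (- (2 * beta))) +
    la^-1 / 2 * (1 ^+ 2 * J `^ (- (2 * delta))))).
  by apply: lerD; apply: ler_wpM2l => //; rewrite divr_ge0 ?invr_ge0// ltW.
have p x y : J `^ (x + y) = J `^ x * J `^ y.
  by rewrite powRD// (gt_eqF J0) implybT.
have e1 : J `^ (- (2 * beta)) = J `^ (- (beta + delta)) * J `^ (- (beta - delta)).
  by rewrite -p; congr (_ `^ _); ring.
have e2 : J `^ (- (2 * delta)) = J `^ (- (beta + delta)) * J `^ (beta - delta).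
  by rewrite -p; congr (_ `^ _); ring.
rewrite e1 e2 [J `^ (- (beta - delta))]powRN /la.
have q0 : J `^ (beta - delta) != 0 by rewrite gt_eqF// powR_gt0.
rewrite le_eqVlt; apply/orP; left; apply/eqP; field.
by rewrite q0 gt_eqF.
Qed.

(** Replacing [g] by its projection on many frequencies costs arbitrarily little
    by completeness; orthonormality then leaves only the frequencies outside the
    box. *)
Lemma approximation_error (beta delta r : R) f g : 0 < beta -> 0 < delta -> 0 < r ->
  sobolev_ball beta r f -> sobolev_ball delta 1 g ->
  `|ip (fun x => f x - projection truncation f x) g| <= r * J `^ (- (beta + delta)).
Proof.
move=> b0 d0 r0 Wf Wg; have [sf _] := Wf; have [sg _] := Wg.
set h := (fun x => _).
have sh : square_integrable h by apply: sqintB => //; exact: sqint_projection.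
apply: (le_of_small_errors (ip_ge0 h)) => e e0.
have [l [pl gl]] := trig_dense sg e0.
pose t := undup (truncation ++ map snd l).
have ut : uniq t by exact: undup_uniq.
have pt : all positive_freq t.
  by apply/allP => k; rewrite mem_undup mem_cat => /orP[]; apply/allP => //; exact: positive_truncation.
have lt : {subset map snd l <= t} by move=> k kl; rewrite mem_undup mem_cat kl orbT.
have sp := sqint_projection t g.
pose u x := g x - projection t g x; have su : square_integrable u by exact: sqintB.
have ue : ip u u <= e by apply: le_trans gl; exact: projection_best.
exists (ip h u), (ip h (projection t g)); split.
- rewrite ipC (ipC h u) (ipC h (projection t g)) -ipDl//.
  by apply: eq_ip => // x _; rewrite /u subrK.
- rewrite /h ip_projection_tail//; [|exact: uniq_truncation|exact: positive_truncation].
  exact: tail_sum_le.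
- by apply: le_trans (cauchy_schwarz sh su) _; apply: ler_wpM2l => //; exact: ip_ge0.
Qed.

Definition coef_error (c : mindex d L -> R) (delta : R) f : R :=
  \sum_j (c j - fourier_coef f (freq j)) ^+ 2 / weight delta (freq j).

(** The free parameter [t] postpones the square root of the risk bound until
    after the expectation is taken. *)
Lemma adversarial_loss_le (beta delta r t : R) f (c : mindex d L -> R) :
  0 < beta -> 0 < delta -> 0 < r -> 0 < t -> sobolev_ball beta r f ->
  (adversarial_loss (sobolev_ball delta 1)
     (fun x => \sum_j c j * fourier (freq j) x)%R f <=
   ((coef_error c delta f / t + t) / 2 + r * J `^ (- (beta + delta)))%:E)%E.
Proof.
move=> b0 d0 r0 t0 Wf; have [sf _] := Wf.
apply: ge_ereal_sup => _ [g Wg <-]; have [sg _] := Wg.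
pose fh : fn := (fun x => \sum_j c j * fourier (freq j) x).
have sfh : square_integrable fh by apply: sqint_sum => j; apply/sqintZ/sqint_fourier.
have sp := sqint_projection truncation f.
rewrite -/fh.
have -> : (\int[mu]_(x in cube d) ((fh x - f x) * g x)%:E = (ip (fun x => (fh x - f x)%R) g)%:E)%E.
  rewrite /ip /Rintegral fineK//; apply: integrable_fin_num => //.
  by apply: sqint_mul => //; exact: sqintB.
rewrite lee_fin.
pose a x := fh x - projection truncation f x; pose h x := f x - projection truncation f x.
have sa : square_integrable a by exact: sqintB.
have sh : square_integrable h by exact: sqintB.
have -> : ip (fun x => fh x - f x) g = ip a g - ip h g.
  by rewrite -ipBl//; apply: eq_ip => // x _; rewrite /a /h; ring.
have := approximation_error b0 d0 r0 Wf Wg; rewrite -/h ler_norml => /andP[hb _].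
suff : ip a g <= (coef_error c delta f / t + t) / 2 by lra.
pose e j := c j - fourier_coef f (freq j).
have -> : ip a g = \sum_j e j * fourier_coef g (freq j).
  transitivity (ip (fun x => \sum_j e j * fourier (freq j) x) g).
    apply: eq_ip => // x _; rewrite /a /fh /projection /truncation.
    rewrite big_map big_enum/= -sumrB; apply: eq_bigr => j _.
    by rewrite -mulrBl.
  rewrite ip_suml//; last by move=> j; apply/sqintZ/sqint_fourier.
  apply: eq_bigr => j _; rewrite ipZl//; last exact: sqint_fourier.
  by rewrite ipC ip_fourier.
have := sobolev_sum_le Wg uniq_truncation positive_truncation.
rewrite expr1n /truncation big_map big_enum/= => gw.
apply: (@le_trans _ _ (\sum_j (e j ^+ 2 / weight delta (freq j) / t / 2 +
    t / 2 * (weight delta (freq j) * fourier_coef g (freq j) ^+ 2)))).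
  apply: ler_sum => j _; set w := weight _ _; set b := fourier_coef g _.
  have w0 : 0 < w by apply: weight_gt0; exact: freq_positive.
  have := sqr_ge0 (e j - t * w * b) => h1.
  have wt0 : 0 < 2 * w * t by rewrite !mulr_gt0.
  rewrite -(ler_pM2r wt0).
  rewrite [leRHS](_ : _ = e j ^+ 2 + (t * w * b) ^+ 2); last by field; rewrite !gt_eqF.
  by move: h1; rewrite sqrrB; nra.
rewrite big_split/= -!mulr_suml -mulr_sumr -/(coef_error c delta f).
have t2 : 0 <= t / 2 by rewrite divr_ge0// ltW.
apply: le_trans (lerD (lexx _) (ler_wpM2l t2 gw)) _.
by rewrite mulr1 [leRHS]mulrDl.
Qed.
End sobolev_loss.

(** * The risk for a given resolution *)

(** The released patterns range over a finite set, so that the loss, a supremum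
    over an uncountable class, is measurable for a trivial reason. *)
Section finite_valued.
Context {R : realType} (disp : measure_display) (T : measurableType disp)
  (P : {measure set T -> \bar R}) (V : finType) (Y : T -> V).
Hypothesis mY : forall v, measurable (Y @^-1` [set v]).

Lemma measurable_finite_valued (dU : measure_display) (U : measurableType dU) (h : V -> U) :
  measurable_fun setT (h \o Y).
Proof.
move=> _ B mB; rewrite setTI.
have -> : (h \o Y) @^-1` B = \bigcup_(v in [set v | B (h v)]) (Y @^-1` [set v]).
  by apply/seteqP; split => [x Bx|x [v Bv xv]] /=; [exists (Y x)|rewrite xv].
by apply: fin_bigcup_measurable => [|v _]; [exact: finite_finset|exact: mY].
Qed.

Lemma integral_finite_valued (h : V -> R) : (forall v, 0 <= h v) ->
  (\int[P]_x (h (Y x))%:E = \sum_(v : V) (h v)%:E * P (Y @^-1` [set v]))%E.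
Proof.
move=> h0.
have hE x : (h (Y x))%:E = (\sum_(v : V) (h v)%:E * (\1_(Y @^-1` [set v]) x)%:E)%E.
  rewrite (bigD1 (Y x))//= indicE mem_set// mule1 big1 ?adde0// => v vY.
  by rewrite indicE memNset ?mule0// => /= e; rewrite e eqxx in vY.
under eq_integral do rewrite hE.
rewrite ge0_integral_sum//.
- apply: eq_bigr => v _; rewrite ge0_integralZl ?lee_fin//.
  + by rewrite integral_indic// setIT.
  + by apply/measurable_EFinP; exact: measurable_indic.
- by move=> v; apply: measurable_funeM; apply/measurable_EFinP; exact: measurable_indic.
- by move=> v x _; rewrite mule_ge0 ?lee_fin.
Qed.
End finite_valued.

Section risk_bound.
Context {R : realType} (d L n : nat) (al : mlevel d L -> R).
Hypotheses (d_gt0 : (0 < d)%N) (al_gt0 : forall l, 0 < al l) (n_gt0 : (0 < n)%N).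
Notation fn := (d.-tuple R -> R).
Notation pattern := {ffun mindex d L -> bool}.

Lemma bounded_on_cube_mechanism (z : pattern) :
  bounded_on_cube (fun x : d.-tuple R => mechanism_pmf al x z).
Proof.
apply: bounded_on_cube_prod => l; rewrite /block_pmf.
apply: bounded_on_cube_sum => v; apply: bounded_on_cubeM; last exact: bounded_on_cube_cst.
apply: bounded_on_cube_prod => j.
have bw : bounded_on_cube (fun x : d.-tuple R =>
    1 / 2 + fourier (freq (val j)) x / (2 * rounding_bound d)).
  apply: bounded_on_cubeD; first exact: bounded_on_cube_cst.
  by apply: bounded_on_cubeM; [exact: bounded_on_cube_fourier|exact: bounded_on_cube_cst].
case: (v j) => //.
have := bounded_on_cubeD (@bounded_on_cube_cst R d 1)
  (bounded_on_cubeM (@bounded_on_cube_cst R d (-1)) bw).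
by under eq_fun do rewrite mulN1r.
Qed.

Section one_density.
Variable (f : fn).
Hypotheses (sf : square_integrable f) (df : is_density f).

(** The unconditional law of the pattern released by one individual.  Writing it
    as a scalar product with [f] gives its sums by linearity. *)
Definition release_prob (z : pattern) : R := ip f (fun x => mechanism_pmf al x z).

Let sqint_mechanism z : square_integrable (fun x : d.-tuple R => mechanism_pmf al x z).
Proof. exact/sqint_bounded/bounded_on_cube_mechanism. Qed.

Lemma sum_release_prob (a : pattern -> R) :
  \sum_z release_prob z * a z = ip f (fun x => \sum_z mechanism_pmf al x z * a z).
Proof.
rewrite ipC (_ : (fun x => _) = (fun x => \sum_z a z * mechanism_pmf al x z)); last first.
  by apply/funext => x; apply: eq_bigr => z _; rewrite mulrC.
rewrite ip_suml//; last by move=> z; exact: sqintZ.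
by apply: eq_bigr => z _; rewrite ipZl// ipC mulrC.
Qed.

Lemma release_prob_sum1 : \sum_z release_prob z = 1.
Proof.
have := sum_release_prob (fun=> 1).
under eq_bigr do rewrite mulr1; move=> ->.
under [X in ip _ X]eq_fun => x do under eq_bigr do rewrite mulr1.
under [X in ip _ X]eq_fun => x do rewrite sum_mechanism_pmf//.
rewrite /ip; under eq_Rintegral do rewrite mulr1.
by have [_ _ ] := df; rewrite /Rintegral => ->.
Qed.

Lemma release_prob_unbiased j :
  \sum_z release_prob z * released al z j = fourier_coef f (freq j).
Proof.
rewrite sum_release_prob -ip_fourier; congr ip.
by apply/funext => x; exact: mechanism_unbiased.
Qed.

Definition noise (j : mindex d L) : R :=
  amplitude (rounding_bound d) (al (level_of j)) (block_dim (level_of j)) ^+ 2.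

Variable S : private_sample al n f.

Let Y w : {ffun 'I_n -> pattern} := [ffun i => ps_Z S i w].

Let mY z : measurable (Y @^-1` [set z]).
Proof.
have -> : Y @^-1` [set z] = \bigcap_(i in [set: 'I_n]) (ps_Z S i @^-1` [set z i]).
  apply/seteqP; split => [w <- i _|w H] /=; first by rewrite ffunE.
  by apply/ffunP => i; rewrite ffunE; exact: H.
apply: fin_bigcap_measurable => [|i _]; first exact: finite_finset.
exact: ps_Z_measurable.
Qed.

Lemma sample_law z : ps_prob S (Y @^-1` [set z]) = (\prod_i release_prob (z i))%:E.
Proof.
have := @ps_law _ _ _ _ _ _ S (fun=> setT) z (fun=> measurableT).
have -> : [set w | forall i, setT (ps_X S i w) /\ ps_Z S i w = z i] = Y @^-1` [set z].
  apply/seteqP; split => [w H|w <- i] /=; last by rewrite ffunE.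
  by apply/ffunP => i; rewrite ffunE; have [] := H i.
move=> ->; rewrite -prodEFin; apply: eq_bigr => i _; rewrite setIT.
rewrite /release_prob /ip /Rintegral fineK//; apply: integrable_fin_num => //.
exact: sqint_mul.
Qed.

(** The loss bound is affine in the weighted quadratic error, whose expectation is
    the sum of the variances. *)
Lemma risk_le (beta delta r t : R) : 0 < beta -> 0 < delta -> 0 < r -> 0 < t ->
  sobolev_ball beta r f ->
  (risk (sobolev_ball delta 1) S <=
   (((\sum_j noise j / weight delta (freq j)) / n%:R / t + t) / 2 +
      r * (dyadic_size L)%:R `^ (- (beta + delta)))%:E)%E.
Proof.
move=> b0 d0 r0 t0 Wf; rewrite /risk; set bias := r * _.
have bias0 : 0 <= bias by rewrite mulr_ge0 ?powR_ge0// ltW.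
pose h (z : {ffun 'I_n -> pattern}) : R :=
  (coef_error (theta_hat al z) delta f / t + t) / 2 + bias.
have w0 (j : mindex d L) : 0 < weight delta (freq j : {ffun 'I_d -> nat}).
  by apply: weight_gt0 => //; exact: freq_positive.
have h0 z : 0 <= h z.
  rewrite addr_ge0// divr_ge0// addr_ge0 ?(ltW t0)// divr_ge0 ?(ltW t0)//.
  by apply: sumr_ge0 => j _; rewrite divr_ge0 ?sqr_ge0 ?(ltW (w0 j)).
pose ell (z : {ffun 'I_n -> pattern}) :=
  adversarial_loss (sobolev_ball delta 1) (projection_estimator al z) f.
have ellE w : adversarial_loss (sobolev_ball delta 1)
    (projection_estimator al (fun i => ps_Z S i w)) f = ell (Y w).
  congr adversarial_loss; apply/funext => x; apply: eq_bigr => j _; congr (_ * _).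
  by congr (_ * _); apply: eq_bigr => i _; rewrite ffunE.
under eq_integral do rewrite ellE.
have ell_ge0 z : (0 <= ell z)%E.
  apply: ereal_sup_ubound; exists (fun=> 0).
    split; first by apply: sqint_bounded; exact: bounded_on_cube_cst.
    rewrite esum1 ?lee_fin ?sqr_ge0// => k _.
    rewrite /fourier_coef; under eq_Rintegral do rewrite mul0r.
    by rewrite Rintegral_cst// mul0r expr0n mulr0.
  by under eq_integral do rewrite mulr0; rewrite integral0.
apply: (@le_trans _ _ (\int[ps_prob S]_w (h (Y w))%:E)%E).
  apply: ge0_le_integral => //.
  - exact: (measurable_finite_valued mY ell).
  - exact: (measurable_finite_valued mY (EFin \o h)).
  - by move=> w _; exact: adversarial_loss_le.
rewrite (integral_finite_valued _ mY h0).
pose p (z : {ffun 'I_n -> pattern}) := \prod_i release_prob (z i).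
rewrite (eq_bigr (fun z => (h z * p z)%:E)); last first.
  by move=> z _; rewrite EFinM; congr (_ * _)%E; exact: sample_law.
rewrite sumEFin lee_fin.
have p1 : \sum_z p z = 1.
  by rewrite -(bigA_distr_bigA (fun _ => release_prob)) big1// => i _; exact: release_prob_sum1.
have -> : \sum_z h z * p z =
    ((\sum_z p z * coef_error (theta_hat al z) delta f) / t + t) / 2 + bias.
  rewrite (eq_bigr (fun z => (p z * coef_error (theta_hat al z) delta f) / t / 2 +
    (t / 2 + bias) * p z)); last by move=> z _; rewrite /h; ring.
  rewrite big_split/= -!mulr_suml -mulr_sumr p1; ring.
rewrite lerD2r ler_pM2r ?invr_gt0// lerD2r ler_pM2r ?invr_gt0//.
under eq_bigr do rewrite mulr_sumr.
rewrite exchange_big/= mulr_suml; apply: ler_sum => j _.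
under eq_bigr do rewrite mulrA.
rewrite -mulr_suml mulrAC ler_pM2r ?invr_gt0//.
apply: (@sample_mean_variance _ _ release_prob (fun z => released al z j)) => //.
- exact: release_prob_sum1.
- exact: release_prob_unbiased.
- by move=> z; exact: released_sqr.
Qed.
End one_density.
End risk_bound.

(** * The noise level under the chosen privacy budget *)

Section noise_level.
Context {R : realType} (d L : nat) (A alpha delta : R).
Hypotheses (d_gt0 : (0 < d)%N) (delta_gt0 : 0 < delta) (alphaA : 0 < alpha <= A).
Implicit Types (l : mlevel d L) (j : mindex d L).

Let gamma : R := (1 - delta / d%:R) / 2.
Let D l : R := (block_dim l)%:R.
Let e l : R := D l `^ gamma.
Let q : R := 2 `^ gamma.
Let al := privacy_levels (d := d) (L := L) alpha delta.
Let S : R := level_sum d L delta.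

Definition geometric (x : R) : R := \sum_(i < L.+1) x ^+ i.

Let D_gt0 l : 0 < D l.
Proof. by rewrite ltr0n /block_dim prodn_gt0// => m; rewrite expn_gt0. Qed.

Let e_gt0 l : 0 < e l. Proof. exact: powR_gt0. Qed.

Let e_le_S l : e l <= S.
Proof.
by rewrite /S /level_sum (bigD1 l)//= lerDl; apply: sumr_ge0 => k _; exact: powR_ge0.
Qed.

Let S_gt0 : 0 < S.
Proof. exact: lt_le_trans (e_gt0 [ffun=> ord0]) (e_le_S _). Qed.

Lemma privacy_levels_gt0 l : 0 < al l.
Proof. by case/andP: alphaA => a0 _; apply: mulr_gt0; [exact: divr_gt0|exact: e_gt0]. Qed.

Lemma privacy_levels_le l : al l <= A.
Proof.
case/andP: alphaA => a0 aA; apply: le_trans aA.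
by rewrite /al /privacy_levels mulrAC ler_pdivrMr// ler_pM2l// e_le_S.
Qed.

Let log_dim l : nat := (\sum_(m < d) l m)%N.

Let D_exp l : D l = 2 ^+ log_dim l.
Proof. by rewrite /D /block_dim -expn_sum natrX. Qed.

Let e_exp l : e l = q ^+ log_dim l.
Proof. by rewrite /e D_exp -powR_mulrn// powRAC powR_mulrn// powR_ge0. Qed.

Let sum_exp (x : R) : \sum_l x ^+ log_dim l = geometric x ^+ d.
Proof.
transitivity (\sum_(l : mlevel d L) \prod_(m < d) x ^+ l m).
  by apply: eq_bigr => l _; rewrite prodrXr.
rewrite -(bigA_distr_bigA (fun (_ : 'I_d) (i : 'I_L.+1) => x ^+ i)).
by rewrite prodr_const card_ord.
Qed.

Lemma level_sumE : S = geometric q ^+ d.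
Proof. by rewrite -sum_exp; apply: eq_bigr => l _; rewrite -e_exp. Qed.

(** The weight is at least its term along the coordinate of highest level, and
    the block dimension is at most the [d]-th power of the dyadic scale there. *)
Lemma weight_ge_dim j : D (level_of j) `^ (2 * delta / d%:R) <= weight delta (freq j).
Proof.
set l := level_of j.
have jl m : (2 ^ l m <= freq j m)%N.
  have : j \in block l by rewrite mem_block.
  by rewrite inE => /forallP/(_ m)/andP[].
pose m0 := [arg max_(m > Ordinal d_gt0) (l m : nat)]%N.
have lm m : (l m <= l m0)%N by rewrite /m0; case: arg_maxnP => // i _; exact.
have D_le : D l <= ((2 ^ l m0)%N%:R) `^ d%:R.
  rewrite powR_mulrn// -natrX ler_nat -expnM.
  rewrite /block_dim -expn_sum leq_exp2l// mulnC -[X in (_ <= X * _)%N]card_ord -sum_nat_const.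
  exact: leq_sum.
apply: le_trans (weight_ge delta (freq j) m0).
apply: (@le_trans _ _ ((((2 ^ l m0)%N%:R) `^ d%:R) `^ (2 * delta / d%:R))).
  by apply: ge0_ler_powR; rewrite ?nnegrE ?powR_ge0 ?(ltW (D_gt0 l))// divr_ge0 ?mulr_ge0// ltW.
rewrite -powRrM (_ : d%:R * _ = 2 * delta); last by field; rewrite pnatr_eq0 -lt0n.
by apply: ge0_ler_powR; rewrite ?nnegrE ?ler0n ?ler_nat// mulr_ge0// ltW.
Qed.

(** The factors collected from the squared amplitude: 4 from the bound on Gamma,
    the squared bound of the basis, and (e^A + 1)^2 since
    (e^a + 1) / (e^a - 1) <= (e^A + 1) / a for 0 < a <= A. *)
Definition noise_constant : R := 4 * rounding_bound d ^+ 2 * (expR A + 1) ^+ 2.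

Lemma noise_constant_gt0 : 0 < noise_constant.
Proof.
by rewrite !mulr_gt0// ?exprn_gt0 ?addr_gt0 ?expR_gt0// powR_gt0.
Qed.

Lemma noise_le j :
  noise al j <= noise_constant * D (level_of j) / al (level_of j) ^+ 2.
Proof.
set l := level_of j; have a0 := privacy_levels_gt0 l; have aA := privacy_levels_le l.
rewrite /noise -/l; pose rho := (expR (al l) + 1) / (expR (al l) - 1).
have -> : amplitude (rounding_bound d) (al l) (block_dim l) ^+ 2 =
    rounding_bound d ^+ 2 * rho ^+ 2 * Gamma (block_dim l) ^+ 2.
  by rewrite /amplitude -/rho 2!exprMn.
have G4 : Gamma (block_dim l) ^+ 2 <= 4 * D l :> R.
  by apply: Gamma_sqr_le; rewrite -(ltr0n R); exact: D_gt0.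
have ratio : (expR (al l) + 1) / (expR (al l) - 1) <= (expR A + 1) / al l.
  have e1 : al l <= expR (al l) - 1 by have := expR_ge1Dx (al l); lra.
  apply: ler_pM.
  - by rewrite addr_ge0// expR_ge0.
  - by rewrite invr_ge0 subr_ge0 -expR0 ler_expR ltW.
  - by rewrite lerD2r ler_expR.
  - by rewrite lef_pV2// posrE// (lt_le_trans a0).
have ratio0 : 0 <= (expR (al l) + 1) / (expR (al l) - 1).
  apply: divr_ge0; first by rewrite addr_ge0 ?expR_ge0.
  by rewrite subr_ge0 -expR0 ler_expR ltW.
have ratio2 : ((expR (al l) + 1) / (expR (al l) - 1)) ^+ 2 <= ((expR A + 1) / al l) ^+ 2.
  by rewrite ler_sqr// nnegrE (le_trans ratio0).
rewrite /noise_constant.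
rewrite [leRHS](_ : _ = rounding_bound d ^+ 2 * ((expR A + 1) / al l) ^+ 2 * (4 * D l)); last first.
  by field; rewrite gt_eqF.
apply: ler_pM => //; [by apply: mulr_ge0; exact: sqr_ge0|exact: sqr_ge0|].
by apply: ler_wpM2l => //; exact: sqr_ge0.
Qed.

(** With D the block dimension and e = D ^ gamma, the identity
    D ^ (2 - 2 delta / d) = e ^ 4 makes the contribution of a block equal to
    e ^ 4 / alpha_l^2 = (S / alpha)^2 e ^ 2 up to the constant. *)
Lemma noise_sum_le : \sum_j noise al j / weight delta (freq j) <=
  noise_constant * (geometric q ^+ (2 * d) * geometric (q ^+ 2) ^+ d) / alpha ^+ 2.
Proof.
have K0 := noise_constant_gt0; have /andP[a0 _] := alphaA.
have Dp0 l : 0 < D l `^ (2 * delta / d%:R) by exact: powR_gt0.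
apply: (@le_trans _ _ (\sum_j noise_constant * D (level_of j) / al (level_of j) ^+ 2 /
    D (level_of j) `^ (2 * delta / d%:R))).
  apply: ler_sum => j _; apply: ler_pM.
  - exact: sqr_ge0.
  - by rewrite invr_ge0 ltW// (lt_le_trans (Dp0 _) (weight_ge_dim j)).
  - exact: noise_le.
  - by rewrite lef_pV2 ?weight_ge_dim// posrE// (lt_le_trans (Dp0 _) (weight_ge_dim j)).
rewrite (partition_big (@level_of d L) predT)//=.
have block_sum l : \sum_(j | level_of j == l) (noise_constant * D (level_of j) /
    al (level_of j) ^+ 2 / D (level_of j) `^ (2 * delta / d%:R)) =
    noise_constant * S ^+ 2 / alpha ^+ 2 * (q ^+ 2) ^+ log_dim l.
  rewrite (eq_bigr (fun=> noise_constant * D l / al l ^+ 2 / D l `^ (2 * delta / d%:R))); last first.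
    by move=> j /eqP ->.
  rewrite sumr_const (_ : #|_| = block_dim l); last first.
    by rewrite -card_block; apply: eq_card => j; rewrite mem_block eq_sym.
  rewrite -[LHS]mulr_natr -/(D l) -exprM mulnC exprM -e_exp.
  rewrite /al /privacy_levels -/(e l) -/S.
  have -> : D l `^ (2 * delta / d%:R) = D l ^+ 2 / e l ^+ 4.
    rewrite -(powR_mulrn 2 (ltW (D_gt0 l))) /e -(powR_mulrn 4 (powR_ge0 _ _)) -powRrM -powRB.
      by congr (_ `^ _); rewrite /gamma; field; rewrite pnatr_eq0 -lt0n.
    by rewrite (gt_eqF (D_gt0 l)) implybT.
  field; rewrite !gt_eqF ?e_gt0 ?D_gt0 ?S_gt0//.
rewrite (eq_bigr _ (fun l _ => block_sum l)) -mulr_sumr sum_exp level_sumE.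
by rewrite -exprM [(2 * d)%N]mulnC le_eqVlt; apply/orP; left; apply/eqP; ring.
Qed.
End noise_level.

Section sup_risk_bound.
Context {R : realType} (d L n : nat) (A alpha beta delta r : R).
Hypotheses (d_gt0 : (0 < d)%N) (beta_gt0 : 0 < beta) (delta_gt0 : 0 < delta) (r_gt0 : 0 < r).
Hypotheses (alphaA : 0 < alpha <= A) (n_alpha : 0 < n%:R * alpha ^+ 2).

Lemma sup_risk_le (t : R) : 0 < t ->
  noise_constant d A *
    (geometric L (2 `^ ((1 - delta / d%:R) / 2)) ^+ (2 * d) *
     geometric L ((2 `^ ((1 - delta / d%:R) / 2)) ^+ 2) ^+ d) <= t ^+ 2 * (n%:R * alpha ^+ 2) ->
  (sup_risk (privacy_levels (d := d) (L := L) alpha delta) n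
      (sobolev_ball beta r) (sobolev_ball delta 1) <=
   (t + r * (dyadic_size L)%:R `^ (- (beta + delta)))%:E)%E.
Proof.
move=> t0 ht; apply: ge_ereal_sup => _ [f [Wf df [S ->]]].
have a0 : 0 < alpha by case/andP: alphaA.
have n0 : (0 < n)%N by rewrite lt0n; apply: contraTneq n_alpha => ->; rewrite mul0r ltxx.
have nR : 0 < n%:R :> R by rewrite ltr0n.
have [sf _] := Wf.
apply: le_trans (risk_le d_gt0 (privacy_levels_gt0 delta alphaA) n0 sf df S beta_gt0 delta_gt0
  r_gt0 t0 Wf) _.
rewrite lee_fin lerD2r.
have := noise_sum_le L d_gt0 delta_gt0 alphaA.
set V := \sum_j _; set G := noise_constant _ _ * _ => VG.
rewrite ler_pdivrMr// mulr_natr mulr2n lerD2r ler_pdivrMr// -expr2 ler_pdivrMr//.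
apply: le_trans VG _; rewrite ler_pdivrMr ?exprn_gt0//.
by apply: le_trans ht _; rewrite mulrA.
Qed.
End sup_risk_bound.

(** * The three regimes *)

Section rates.
Context {R : realType}.
Implicit Types (q x : R) (L : nat).

Lemma geometric_gt1 L q : 1 < q -> geometric L q <= q / (q - 1) * q ^+ L.
Proof.
move=> q1; rewrite mulrAC ler_pdivlMr ?subr_gt0// mulrC -subrX1 -exprS.
by rewrite gerBl.
Qed.

Lemma geometric_lt1 L q : 0 <= q < 1 -> geometric L q <= (1 - q)^-1.
Proof.
move=> /andP[q0 q1]; rewrite -[leRHS]mul1r ler_pdivlMr ?subr_gt0// mulrC.
by rewrite -[1 - q]opprB mulNr -subrX1 opprB gerBl exprn_ge0.
Qed.

Lemma geometric_1 L : geometric L 1 = L.+1%:R :> R.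
Proof.
rewrite /geometric (eq_bigr (fun=> 1)) => [|i _]; last by rewrite expr1n.
by rewrite sumr_const card_ord.
Qed.

Lemma geometric_ge0 L q : 0 <= q -> 0 <= geometric L q.
Proof. by move=> q0; apply: sumr_ge0 => i _; exact: exprn_ge0. Qed.

Lemma exp2_le_dyadic_size L : 2 ^+ L <= (dyadic_size L)%:R :> R.
Proof.
rewrite -natrX ler_nat /dyadic_size expnS.
have : (0 < 2 ^ L)%N by rewrite expn_gt0.
lia.
Qed.

Lemma bias_of_order (c1 c2 J M s : R) : 0 < c1 -> 0 < M -> 0 < s -> of_order c1 c2 J M ->
  J `^ (- s) <= c1 `^ (- s) * M `^ (- s).
Proof.
move=> c0 M0 s0 /andP[+ _]; rewrite ler_pdivlMr// => cJ.
have cM : 0 < c1 * M by exact: mulr_gt0.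
rewrite -powRM ?(ltW c0) ?(ltW M0)// !powRN lef_pV2 ?posrE ?powR_gt0//; last exact: lt_le_trans cJ.
by apply: ge0_ler_powR; rewrite ?nnegrE ?(ltW s0) ?(ltW cM)// (le_trans (ltW cM)).
Qed.

Lemma powRX x (s : R) n : (x `^ s) ^+ n = x `^ (s * n%:R).
Proof. by rewrite powRrM powR_mulrn// powR_ge0. Qed.

Lemma sqrt_powR_sqr (X N s : R) : 0 <= X -> (Num.sqrt X * N `^ s) ^+ 2 = X * N `^ (2 * s).
Proof. by move=> X0; rewrite exprMn sqr_sqrtr// powRX [s * _]mulrC. Qed.

Lemma exp2_powR L (s : R) : (2 `^ s) ^+ L = (2 ^+ L) `^ s.
Proof. by rewrite -powR_mulrn ?powR_ge0// powRAC powR_mulrn. Qed.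

Lemma powR2_gt1 (s : R) : 0 < s -> 1 < 2 `^ s.
Proof.
move=> s0; have : (1 : R) `^ s < 2 `^ s by apply: gt0_ltr_powR; rewrite ?nnegrE ?ltr1n.
by rewrite powR1.
Qed.

(** When the exponent [s] is positive the geometric sums are governed by their
    last term, a power of the resolution. *)
Lemma geometric_rate L (s : R) : 0 < s ->
  geometric L (2 `^ s) <= 2 `^ s / (2 `^ s - 1) * (dyadic_size L)%:R `^ s.
Proof.
move=> s0; have q1 := powR2_gt1 s0.
apply: le_trans (geometric_gt1 L q1) _; apply: ler_wpM2l.
  by rewrite divr_ge0 ?powR_ge0// subr_ge0 ltW.
rewrite exp2_powR; apply: ge0_ler_powR; rewrite ?nnegrE ?ler0n ?exprn_ge0// ?(ltW s0)//.
exact: exp2_le_dyadic_size.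
Qed.

(** The three regimes differ only in the size of this growth factor. *)
Definition growth (d L : nat) (gamma : R) : R :=
  geometric L (2 `^ gamma) ^+ (2 * d) * geometric L ((2 `^ gamma) ^+ 2) ^+ d.

Lemma growth_gt0 d (gamma : R) : 0 < gamma -> exists2 X : R, 0 < X &
  forall L, growth d L gamma <= X * (dyadic_size L)%:R `^ (4 * gamma * d%:R).
Proof.
move=> g0; have g20 : 0 < gamma * 2 by rewrite mulr_gt0.
pose c (s : R) := 2 `^ s / (2 `^ s - 1) : R.
have c0 s : 0 < s -> 0 < c s.
  by move=> s0; rewrite divr_gt0 ?powR_gt0// subr_gt0 powR2_gt1.
exists (c gamma ^+ (2 * d) * c (gamma * 2) ^+ d).
  by rewrite mulr_gt0// exprn_gt0// c0.
move=> L; set J : R := (dyadic_size L)%:R.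
have J0 : 0 < J.
  by apply: lt_le_trans (exp2_le_dyadic_size L); rewrite exprn_gt0.
rewrite /growth powRX.
have E : J `^ (4 * gamma * d%:R) = (J `^ gamma) ^+ (2 * d) * (J `^ (gamma * 2)) ^+ d.
  rewrite !powRX -powRD; last by rewrite (gt_eqF J0) implybT.
  by congr (_ `^ _); rewrite natrM; ring.
rewrite E mulrACA -!exprMn.
apply: ler_pM; rewrite ?exprn_ge0 ?geometric_ge0 ?powR_ge0//.
- apply: lerXn2r; rewrite ?nnegrE ?geometric_ge0 ?powR_ge0// ?geometric_rate//.
  by rewrite mulr_ge0 ?powR_ge0// ltW// c0.
- apply: lerXn2r; rewrite ?nnegrE ?geometric_ge0 ?powR_ge0// ?geometric_rate//.
  by rewrite mulr_ge0 ?powR_ge0// ltW// c0.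
Qed.

Lemma growth_eq0 d L : growth d L 0 = L.+1%:R ^+ (3 * d) :> R.
Proof.
rewrite /growth powRr0 expr1n geometric_1 -exprD; congr (_ ^+ _); lia.
Qed.

Lemma growth_lt0 d (gamma : R) : gamma < 0 -> exists2 X : R, 0 < X &
  forall L, growth d L gamma <= X.
Proof.
move=> g0; pose q : R := 2 `^ gamma.
have q0 : 0 <= q by exact: powR_ge0.
have q1 : q < 1.
  rewrite /q -[gamma]opprK powRN invf_lt1 ?powR_gt0// powR2_gt1//; lra.
have q20 : 0 <= q ^+ 2 by exact: sqr_ge0.
have q21 : q ^+ 2 < 1 by rewrite expr_lt1.
exists ((1 - q)^-1 ^+ (2 * d) * (1 - q ^+ 2)^-1 ^+ d).
  by rewrite mulr_gt0// exprn_gt0// invr_gt0 subr_gt0.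
move=> L; rewrite /growth -/q.
have i1 : 0 <= (1 - q)^-1 by rewrite invr_ge0 subr_ge0 ltW.
have i2 : 0 <= (1 - q ^+ 2)^-1 by rewrite invr_ge0 subr_ge0 ltW.
apply: ler_pM; rewrite ?exprn_ge0 ?geometric_ge0//.
- by apply: lerXn2r; rewrite ?nnegrE ?geometric_ge0// geometric_lt1 ?q0.
- by apply: lerXn2r; rewrite ?nnegrE ?geometric_ge0// geometric_lt1 ?q20.
Qed.

(** The prescribed resolution is at most a power of [N], up to powers of [ln N]
    that are bounded below because [N] stays away from 1; taking logarithms bounds
    the number of levels. *)
Lemma level_le_ln (c2 kappa rho : R) (k L : nat) (N : R) :
  0 < c2 -> 0 < kappa -> 1 < rho -> rho <= N ->
  (dyadic_size L)%:R <= c2 * (N / ln N ^+ k) `^ kappa ->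
  L.+1%:R <= ((1 + (`|ln c2| + kappa * (k%:R * `|ln (ln rho)|)) / ln 2) / ln rho
               + kappa / ln 2) * ln N.
Proof.
move=> c0 k0 r1 rN J.
have ln2 : 0 < ln 2 :> R by rewrite ln_gt0// ltr1n.
have lr : 0 < ln rho by rewrite ln_gt0.
have N0 : 0 < N by apply: lt_le_trans rN; lra.
have lN : ln rho <= ln N by rewrite ler_ln// posrE; lra.
have lN0 : 0 < ln N by exact: lt_le_trans lN.
have lk0 : 0 < ln N ^+ k by rewrite exprn_gt0.
have M0 : 0 < N / ln N ^+ k by exact: divr_gt0.
have lnL : L%:R * ln 2 <= ln c2 + kappa * (ln N - k%:R * ln (ln N)).
  have -> : L%:R * ln 2 = ln (2 ^+ L) :> R by rewrite lnXn// mulr_natl.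
  have -> : ln c2 + kappa * (ln N - k%:R * ln (ln N)) = ln (c2 * (N / ln N ^+ k) `^ kappa).
    rewrite lnM ?posrE ?powR_gt0// ln_powR lnM ?posrE ?invr_gt0// lnV ?posrE//.
    by rewrite lnXn// mulr_natl.
  rewrite ler_ln ?posrE ?exprn_gt0 ?mulr_gt0 ?powR_gt0//.
  exact: le_trans (exp2_le_dyadic_size L) J.
have lln : ln (ln rho) <= ln (ln N) by rewrite ler_ln.
set B := `|ln c2| + kappa * (k%:R * `|ln (ln rho)|).
have B0 : 0 <= B by rewrite addr_ge0// !mulr_ge0// ltW.
have LB : L%:R * ln 2 <= B + kappa * ln N.
  apply: le_trans lnL _; rewrite mulrBr /B.
  have h1 := ler_norm (ln c2).
  have h2 : - (kappa * (k%:R * ln (ln N))) <= kappa * (k%:R * `|ln (ln rho)|).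
    rewrite -mulrN ler_pM2l// -mulrN ler_wpM2l//.
    by have := ler_norm (- ln (ln rho)); rewrite normrN; lra.
  lra.
have L1 : L%:R <= B / ln 2 + kappa / ln 2 * ln N.
  by rewrite mulrAC -mulrDl ler_pdivlMr.
have one : 1 + B / ln 2 <= (1 + B / ln 2) / ln rho * ln N.
  rewrite mulrAC -mulrA ler_peMr//; last by rewrite ler_pdivlMr// mul1r.
  by rewrite addr_ge0// divr_ge0// ltW.
rewrite -natr1 mulrDl; lra.
Qed.
End rates.

(** With [t] proportional to the target rate, noise and approximation error
    are balanced. *)
Lemma sup_risk_rate (R : realType) (d L n : nat) (A alpha beta delta r c1 c2 X M kap s : R) :
  (0 < d)%N -> 0 < beta -> 0 < delta -> 0 < r -> 0 < alpha <= A ->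
  0 < n%:R * alpha ^+ 2 -> 0 < c1 -> 0 < X -> 0 < M ->
  of_order c1 c2 (dyadic_size L)%:R (M `^ kap) -> kap * (beta + delta) = s ->
  noise_constant d A * growth d L ((1 - delta / d%:R) / 2) <=
    X * M `^ (- (2 * s)) * (n%:R * alpha ^+ 2) ->
  (sup_risk (privacy_levels (d := d) (L := L) alpha delta) n
      (sobolev_ball beta r) (sobolev_ball delta 1) <=
   ((Num.sqrt X + r * c1 `^ (- (beta + delta))) * M `^ (- s))%:E)%E.
Proof.
move=> d0 b0 de0 r0 aA N0 c0 X0 M0 HJ ks noise_X.
have bd0 : 0 < beta + delta by rewrite addr_gt0.
have t0 : 0 < Num.sqrt X * M `^ (- s) by rewrite mulr_gt0 ?sqrtr_gt0 ?powR_gt0.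
apply: le_trans (@sup_risk_le _ d L n A alpha beta delta r d0 b0 de0 r0 aA N0 _ t0 _) _.
  by rewrite sqrt_powR_sqr ?(ltW X0)// mulrN.
rewrite lee_fin mulrDl lerD2l -mulrA ler_pM2l//.
apply: le_trans (bias_of_order c0 (powR_gt0 kap M0) bd0 HJ) _.
by rewrite -powRrM mulrN ks.
Qed.

Theorem theorem2p2 (R : realType) (d : nat) (A beta delta r c1 c2 : R)
    (d_ge1 : (1 <= d)%N) (A_gt0 : 0 < A) (beta_gt0 : 0 < beta)
    (delta_gt0 : 0 < delta) (r_gt0 : 0 < r) (r_ge : d%:R <= r ^+ 2)
    (c1_gt0 : 0 < c1) (c2_gt0 : 0 < c2) :
  let maximal_risk n alpha L :=
    sup_risk (privacy_levels (d := d) (L := L) alpha delta) n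
      (sobolev_ball beta r) (sobolev_ball delta 1) in
  [/\ delta < d%:R ->
      exists2 C : R, 0 < C &
      forall (n : nat) (alpha : R) (L : nat),
        0 < alpha <= A -> 1 < n%:R * alpha ^+ 2 ->
        of_order c1 c2 (dyadic_size L)%:R
          ((n%:R * alpha ^+ 2) `^ (1 / (2 * beta + 2 * d%:R))) ->
        (maximal_risk n alpha L <=
          (C * (n%:R * alpha ^+ 2) `^ (- ((beta + delta) / (2 * beta + 2 * d%:R))))%:E)%E,
      (* rho keeps n alpha^2 away from 1, where the logarithm vanishes *)
      delta = d%:R ->
      forall rho : R, 1 < rho ->
      exists2 C : R, 0 < C &
      forall (n : nat) (alpha : R) (L : nat),
        0 < alpha <= A -> rho <= n%:R * alpha ^+ 2 ->
        of_order c1 c2 (dyadic_size L)%:R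
          ((n%:R * alpha ^+ 2 / ln (n%:R * alpha ^+ 2) ^+ (4 * d))
             `^ (1 / (2 * beta + 2 * delta))) ->
        (maximal_risk n alpha L <=
          (C * (n%:R * alpha ^+ 2 / ln (n%:R * alpha ^+ 2) ^+ (4 * d))
                 `^ (- (1 / 2)))%:E)%E
    & d%:R < delta ->
      exists2 C : R, 0 < C &
      forall (n : nat) (alpha : R) (L : nat),
        0 < alpha <= A -> 1 < n%:R * alpha ^+ 2 ->
        of_order c1 c2 (dyadic_size L)%:R
          ((n%:R * alpha ^+ 2) `^ (1 / (2 * beta + 2 * delta))) ->
        (maximal_risk n alpha L <=
          (C * (n%:R * alpha ^+ 2) `^ (- (1 / 2)))%:E)%E].
Proof.
have d0 : 0 < d%:R :> R by rewrite ltr0n.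
have [K KE K0] : exists2 K, noise_constant d A = K & 0 < K.
  by exists (noise_constant d A) => //; exact: noise_constant_gt0.
have bd0 : 0 < beta + delta by rewrite addr_gt0.
have C0 X : 0 < X -> 0 < Num.sqrt X + r * c1 `^ (- (beta + delta)).
  by move=> X0; rewrite addr_gt0 ?sqrtr_gt0// mulr_gt0// powR_gt0.
split.
- move=> dd; have g0 : 0 < (1 - delta / d%:R) / 2.
    by rewrite divr_gt0// subr_gt0 ltr_pdivrMr// mul1r.
  have [X1 X10 HX1] := growth_gt0 d g0.
  pose X := K * (X1 * c2 `^ (2 * (d%:R - delta))).
  have X0 : 0 < X by rewrite !mulr_gt0// powR_gt0.
  exists (Num.sqrt X + r * c1 `^ (- (beta + delta))); first exact: C0.
  move=> n alpha L aA N1 HJ; set N := n%:R * alpha ^+ 2 in N1 HJ *.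
  have N0 : 0 < N by exact: lt_trans N1.
  apply: (sup_risk_rate d_ge1 _ _ _ aA N0 c1_gt0 X0 N0 HJ) => //.
    by rewrite mulrC mul1r.
  have den0 : 2 * beta + 2 * d%:R != 0 by rewrite gt_eqF// addr_gt0// mulr_gt0.
  rewrite KE /X -/N -2!mulrA ler_pM2l// -mulrA; apply: le_trans (HX1 L) _; rewrite ler_pM2l//.
  have -> : 4 * ((1 - delta / d%:R) / 2) * d%:R = 2 * (d%:R - delta).
    by field; rewrite gt_eqF.
  have [_ +] := andP HJ; rewrite ler_pdivrMr ?powR_gt0// => Jc.
  have e0 : 0 <= 2 * (d%:R - delta) by rewrite mulr_ge0// subr_ge0 ltW.
  apply: le_trans (ge0_ler_powR e0 _ _ Jc) _; rewrite ?nnegrE ?mulr_ge0 ?powR_ge0 ?(ltW c2_gt0)//.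
  rewrite powRM ?powR_ge0 ?(ltW c2_gt0)// ler_pM2l ?powR_gt0//.
  rewrite -powRrM -[X in _ <= _ * X](powRr1 (ltW N0)) -powRD; last by rewrite (gt_eqF N0) implybT.
  by rewrite le_eqVlt; apply/orP; left; apply/eqP; congr (_ `^ _); field.
- move=> dd rho rho1; have lr0 : 0 < ln rho by rewrite ln_gt0.
  pose kap := 1 / (2 * beta + 2 * delta).
  have kap0 : 0 < kap by rewrite divr_gt0// addr_gt0// mulr_gt0.
  pose c := (1 + (`|ln c2| + kap * ((4 * d)%:R * `|ln (ln rho)|)) / ln 2) / ln rho + kap / ln 2.
  have l20 : 0 < ln 2 :> R by rewrite ln_gt0// ltr1n.
  have c0 : 0 < c.
    apply: addr_gt0; last exact: divr_gt0.
    apply: divr_gt0 => //; apply: ltr_wpDr => //; apply: divr_ge0; last exact: ltW.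
    by apply: addr_ge0 => //; apply: mulr_ge0; [exact: ltW|exact: mulr_ge0].
  pose X := K * c ^+ (4 * d).
  have X0 : 0 < X by rewrite mulr_gt0// exprn_gt0.
  exists (Num.sqrt X + r * c1 `^ (- (beta + delta))); first exact: C0.
  move=> n alpha L aA N1 HJ; set N := n%:R * alpha ^+ 2 in N1 HJ *.
  have N0 : 0 < N by apply: lt_le_trans N1; lra.
  have lN0 : 0 < ln N by rewrite ln_gt0// (lt_le_trans rho1).
  have lk0 : 0 < ln N ^+ (4 * d) by rewrite exprn_gt0.
  have M0 : 0 < N / ln N ^+ (4 * d) by exact: divr_gt0.
  apply: (sup_risk_rate d_ge1 _ _ _ aA N0 c1_gt0 X0 M0 HJ) => //.
    by field; rewrite gt_eqF// addr_gt0// mulr_gt0.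
  rewrite -/N; have -> : (1 - delta / d%:R) / 2 = 0 by rewrite dd divff ?gt_eqF// subrr mul0r.
  rewrite KE growth_eq0 /X -/N -2!mulrA ler_pM2l//.
  have -> : (N / ln N ^+ (4 * d)) `^ (- (2 * (1 / 2))) * N = ln N ^+ (4 * d).
    rewrite (_ : 2 * (1 / 2) = 1); last by field.
    by rewrite powR_inv1 ?(ltW M0)// invf_div divfK// gt_eqF.
  rewrite -exprMn.
  have [_ +] := andP HJ; rewrite ler_pdivrMr ?powR_gt0// => Jc.
  have Lc := level_le_ln c2_gt0 kap0 rho1 N1 Jc.
  apply: (@le_trans _ _ (L.+1%:R ^+ (4 * d))).
    have le34 : (3 * d <= 4 * d)%N by rewrite leq_mul2r orbT.
    by apply: ler_weXn2l le34; rewrite ler1n.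
  by apply: lerXn2r; rewrite ?nnegrE ?ler0n// mulr_ge0// ltW.
- move=> dd; have g0 : (1 - delta / d%:R) / 2 < 0.
    by rewrite pmulr_llt0 ?invr_gt0// subr_lt0 ltr_pdivlMr// mul1r.
  have [X1 X10 HX1] := growth_lt0 d g0.
  pose X := K * X1.
  have X0 : 0 < X by rewrite mulr_gt0.
  exists (Num.sqrt X + r * c1 `^ (- (beta + delta))); first exact: C0.
  move=> n alpha L aA N1 HJ; set N := n%:R * alpha ^+ 2 in N1 HJ *.
  have N0 : 0 < N by exact: lt_trans N1.
  apply: (sup_risk_rate d_ge1 _ _ _ aA N0 c1_gt0 X0 N0 HJ) => //.
    by field; rewrite gt_eqF// addr_gt0// mulr_gt0.
  rewrite KE /X -/N -2!mulrA ler_pM2l//.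
  have -> : N `^ (- (2 * (1 / 2))) * N = 1.
    rewrite (_ : 2 * (1 / 2) = 1); last by field.
    by rewrite powR_inv1 ?(ltW N0)// mulVf// gt_eqF.
  by rewrite mulr1.
Qed.
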